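(* Let $k\ge2$ be a fixed integer and let $C_{k,n}=\frac{1}{kn+1}\binom{(k+1)n}{n}$, $n=0,1,2,\ldots$ (Fuss--Catalan numbers of order $k$). Then: (a) $\{C_{k,n}\}_{n=0}^\infty$ is an infinitely divisible Stieltjes moment sequence. (b) For each real $c>0$, the power sequence $\{C_{k,n}^c\}_{n=0}^\infty$ is Stieltjes determinate. (c) For each real $c>0$, the (unique) measure $\mu_{k,c}$ on $[0,\infty)$ with moment sequence $\{C_{k,n}^c\}_{n=0}^\infty$ has Mellin transform $$\int_0^\infty t^s\,d\mu_{k,c}(t)=\left(\frac{1}{ks+1}\cdot\frac{\Gamma((k+1)s+1)}{\Gamma(s+1)\Gamma(ks+1)}\right)^c,\quad s\ge0.$$
   Context: A real sequence $\{m_n\}_{n=0}^\infty$ is a Stieltjes moment sequence if there is a nonnegative measure $\mu$ on $[0,\infty)$ with $m_n=\int_{[0,\infty)}x^n\,d\mu(x)$ for all $n\ge0$; it is Stieltjes determinate if such $\mu$ is unique. A Stieltjes moment sequence $\{m_n\}$ is infinitely divisible (in the sense of Tyan) if $\{m_n^c\}_{n=0}^\infty$ is a Stieltjes moment sequence for every real $c>0$. *)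

(* Defs.v *)
From HB Require Import structures.
From mathcomp Require Import all_boot all_order all_algebra.
From mathcomp Require Import all_classical all_reals all_analysis.

Set Implicit Arguments.
Unset Strict Implicit.
Unset Printing Implicit Defensive.

Import Order.TTheory GRing.Theory Num.Theory.
Import numFieldNormedType.Exports.

Local Open Scope classical_set_scope.
Local Open Scope ring_scope.

(* A measure on [0, +oo[ is encoded as a Borel measure on R that gives no mass
   to the negative half-line. The integral is extended-real-valued and its
   integrand is nonnegative, so the equality below includes finiteness of all
   moments. Also, x ^+ 0 = 1 at x = 0. *)
Definition stieltjes_representing (R : realType)
    (mu : {measure set (measurableTypeR R) -> \bar R}) (m : nat -> R) : Prop :=
  mu [set x : R | x < 0] = 0%E /\
  forall n : nat, (m n)%:E = (\int[mu]_(x in `[0%R, +oo[) (x ^+ n)%:E)%E.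

Definition stieltjes_moment_sequence (R : realType) (m : nat -> R) : Prop :=
  exists mu : {measure set (measurableTypeR R) -> \bar R},
    stieltjes_representing mu m.

(* A measure in the library is a function on all sets, whose values outside the
   sigma-algebra are irrelevant: uniqueness is agreement on Borel sets. *)
Definition stieltjes_determinate (R : realType) (m : nat -> R) : Prop :=
  stieltjes_moment_sequence m /\
  forall mu nu : {measure set (measurableTypeR R) -> \bar R},
    stieltjes_representing mu m -> stieltjes_representing nu m ->
    forall A : set (measurableTypeR R), measurable A -> mu A = nu A.

Definition infinitely_divisible (R : realType) (m : nat -> R) : Prop :=
  stieltjes_moment_sequence m /\
  forall c : R, 0 < c -> stieltjes_moment_sequence (fun n => m n `^ c).

Definition fuss_catalan (R : realType) (k n : nat) : R :=
  (k * n + 1)%:R^-1 * 'C((k + 1) * n, n)%:R.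

(* Euler's integral, meaningful for z > 0. *)
Definition Gamma (R : realType) (z : R) : R :=
  \int[@lebesgue_measure R]_(x in `]0, +oo[) (x `^ (z - 1) * expR (- x)).

(* Main.v *)
Require Import Defs.
From HB Require Import structures.
From mathcomp Require Import all_boot all_order all_algebra.
From mathcomp Require Import all_classical all_reals all_analysis.
From mathcomp Require Import measurable_realfun ring lra zify.
Import Order.TTheory GRing.Theory Num.Theory.
Import numFieldNormedType.Exports.
Local Open Scope classical_set_scope.
Local Open Scope ring_scope.

Set Implicit Arguments.
Unset Strict Implicit.
Unset Printing Implicit Defensive.

(** Write F(s) for the right-hand side of (c) with c = 1 and put
    K = (k+1)^(k+1) / k^k. Euler's product for Gamma gives F(s) / K^s as an
    infinite product of factors (1 + s/b) / (1 + s/a) with 0 < a <= b. Since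
    ln ((s+b)/(s+a)) is the sum over n >= 1 of ((b-a)/(s+b))^n / n, and finite
    measures on the half-line are closed under convolution and countable sums,
    every power c > 0 of such a factor is the Laplace transform of a probability
    measure. Partial products are Laplace transforms of sums of more and more
    nonnegative independent variables, so under X = exp (- V) their laws
    decrease stochastically; their quantile functions on [0, 1] then decrease
    pointwise, and the limit has Mellin transform (F(s) / K^s)^c. Rescaling by
    K^c gives a measure with the required Mellin transform, in particular with
    moments C_{k,n}^c.

    These moments are bounded by b^n, so any representing measure lives on
    [0, 2b]; there the polynomials (1 - (t/B)^n)^N with N about (B/x)^n / n tend
    boundedly to the indicator of [0, x], so the moments determine the measure. *)

(** * Pushforward measures and integrals of real powers *)

Lemma pushforward_exists d d' (T : measurableType d) (T' : measurableType d')
    (R : realType) (mu : {measure set T -> \bar R}) (phi : T -> T') :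
  measurable_fun setT phi ->
  exists nu : {measure set T' -> \bar R},
    (forall A, nu A = mu (phi @^-1` A)) /\
    forall f : T' -> \bar R, measurable_fun setT f -> (forall y, 0 <= f y)%E ->
      (\int[nu]_y f y = \int[mu]_x f (phi x))%E.
Proof.
move=> mphi.
pose nu : {measure set T' -> \bar R} :=
  measure_function_pushforward__canonical__measure_function_Measure mu mphi.
exists nu; split; first by move=> A.
move=> f mf f0; exact: (@ge0_integral_pushforward _ _ _ _ _ _ mphi mu setT).
Qed.

Section powR_integral.
Context {R : realType}.
Implicit Types (p x z t : R).

Lemma continuous_powR_base p x : 0 < x -> {for x, continuous (@powR R ^~ p)}.
Proof.
move=> x0; apply: differentiable_continuous; apply/derivable1_diffP.
by apply: derivable_powR; rewrite in_itv/= x0.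
Qed.

(** For [p = 0] the convention 0^0 = 1 makes the power constant, so the limit still agrees with the
    value at 0. *)
Lemma powR_cvg_at_right0 p : 0 <= p -> x `^ p @[x --> 0^'+] --> (0 : R) `^ p.
Proof.
rewrite le_eqVlt => /predU1P[<-|p0].
  by rewrite powRr0; under eq_fun do rewrite powRr0; exact: cvg_cst.
by rewrite powR0 ?gt_eqF//; exact: powR_cvg0.
Qed.

Lemma powR_cvg_seq (u : nat -> R) (l p : R) : (forall n, 0 <= u n) -> 0 < p ->
  u @ \oo --> l -> u n `^ p @[n --> \oo] --> l `^ p.
Proof.
move=> u0 p0 ul; have : 0 <= l.
  rewrite -(cvg_lim _ ul)//; apply: limr_ge; first by apply/cvg_ex; exists l.
  exact: nearW.
rewrite le_eqVlt => /predU1P[l0|l0]; last first.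
  by apply: (@cvg_comp _ _ _ u (@powR R ^~ p) _ (nbhs l)) => //; exact: continuous_powR_base.
rewrite -l0 powR0 ?gt_eqF//; apply/cvgrPdist_lt => e e0.
have e0' : 0 < e `^ p^-1 by exact: powR_gt0.
move: ul; rewrite -l0 => /cvgrPdist_lt/(_ _ e0'); apply: filterS => n.
rewrite !sub0r !normrN !ger0_norm ?powR_ge0// => un.
have -> : e = (e `^ p^-1) `^ p by rewrite -powRrM mulVf ?gt_eqF// powRr1// ltW.
by apply: gt0_ltr_powR; rewrite ?nnegrE// ltW.
Qed.

Lemma integral_powR z t : 0 <= z -> 0 < t ->
  (\int[lebesgue_measure]_(x in `[0%R, t]) ((z + 1) * x `^ z)%:E = (t `^ (z + 1))%:E)%E.
Proof.
move=> z0 t0; have z1 : 0 < z + 1 by lra.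
rewrite (@continuous_FTC2 _ _ (@powR R ^~ (z + 1)))//.
- by rewrite powR0 ?gt_eqF// sube0.
- apply/continuous_within_itvP => //; split.
  + move=> x; rewrite in_itv/= => /andP[x0 _].
    by apply: cvgMl_tmp; exact: continuous_powR_base.
  + by apply: cvgMl_tmp; exact: powR_cvg_at_right0.
  + by apply: cvgMl_tmp; apply: cvg_at_left_filter; exact: continuous_powR_base.
- split.
  + move=> x; rewrite in_itv/= => /andP[x0 _].
    by apply: derivable_powR; rewrite in_itv/= x0.
  + by apply: powR_cvg_at_right0; exact: ltW.
  + by apply: cvg_at_left_filter; exact: continuous_powR_base.
- move=> x; rewrite in_itv/= => /andP[x0 _].
  by rewrite powR_derive1 ?in_itv/= ?x0// addrK.
Qed.

End powR_integral.

(** * Laplace transforms of finite measures *)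

Section laplace.
Context {R : realType}.
Notation rT := (measurableTypeR R).

(* The measure lives on R rather than on [0, +oo[; the absolute value folds it
   onto the half-line, so no support condition has to be carried around. *)
Definition laplace_rep (h : R -> R) : Prop :=
  exists mu : {finite_measure set rT -> \bar R},
    forall s, 0 <= s -> (\int[mu]_v (expR (- (s * `|v|)))%:E = (h s)%:E)%E.

Lemma measurable_laplace_kernel (s : R) :
  measurable_fun [set: rT] (fun v : rT => (expR (- (s * `|v|)))%:E).
Proof.
apply/measurable_EFinP; apply: measurableT_comp => //.
apply: measurableT_comp => //; apply: measurable_funM => //.
Qed.

(** Equips the same set function with the finite-measure structure on which the product measures
    below rely. *)
Lemma finite_measure_exists (mu : {measure set rT -> \bar R}) :
  (mu setT < +oo)%E ->
  exists nu : {finite_measure set rT -> \bar R}, forall A, nu A = mu A.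
Proof.
move=> muT.
have fin : fin_num_fun mu.
  move=> A mA; rewrite ge0_fin_numE//; apply: le_lt_trans muT.
  by apply: le_measure; rewrite ?inE.
have sig : sigma_finite setT mu.
  by apply: fin_num_fun_sigma_finite => //; rewrite measure0.
pose H1 := isFinite.Build _ _ _ _ fin.
pose H2 := isSFinite.Build _ _ _ _ (sfinite_measure_sigma_finite sig).
pose H3 := isSigmaFinite.Build _ _ _ _ sig.
by exists (HB.pack_for (FiniteMeasure.type rT R) (Measure.sort mu) H1 H2 H3).
Qed.

(** At [s = 0] the transform is the total mass, so the real value [h 0] forces finiteness. *)
Lemma laplace_rep_measure (h : R -> R) (mu : {measure set rT -> \bar R}) :
  (forall s, 0 <= s -> (\int[mu]_v (expR (- (s * `|v|)))%:E = (h s)%:E)%E) ->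
  laplace_rep h.
Proof.
move=> hE.
have [|nu nuE] := @finite_measure_exists mu.
  have := hE 0 (lexx _).
  under eq_integral do rewrite mul0r oppr0 expR0.
  by rewrite integral_cst// mul1e => ->; rewrite ltry.
by exists nu => s s0; rewrite -hE//; apply: eq_measure_integral => A _ _; exact: nuE.
Qed.

Lemma laplace_rep_ext (h g : R -> R) : (forall s, 0 <= s -> h s = g s) ->
  laplace_rep h -> laplace_rep g.
Proof. by move=> hg [mu muE]; exists mu => s s0; rewrite -hg// muE. Qed.

Lemma laplace_rep_cst (r : R) : 0 <= r -> laplace_rep (fun=> r).
Proof.
move=> r0; apply: (@laplace_rep_measure _ (mscale (NngNum r0) (dirac (0 : rT)))) => s s0.
rewrite ge0_integral_mscale//; last exact: measurable_laplace_kernel.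
rewrite integral_dirac//; last exact: measurable_laplace_kernel.
by rewrite diracT mul1e/= normr0 mulr0 oppr0 expR0 mule1.
Qed.

Lemma measurable_expRN_norm : measurable_fun [set: rT] (fun v : rT => expR (- `|v|)).
Proof. by apply: measurableT_comp => //; apply: measurableT_comp. Qed.

Lemma measurable_tail_set (x : R) : measurable [set v : rT | (x < expR (- `|v|))%R].
Proof.
have := @measurable_fun_ltr _ _ _ [set: rT] (cst x) _ (@measurable_cst _ _ _ _ _ x)
  measurable_expRN_norm.
by move=> /(_ measurableT [set true]); rewrite setTI; exact.
Qed.

(** [m] is the law of |v| + |w| under the product measure. Adding |w| can only lower exp (- |v|), so
    for a probability [nu] the tails of X = exp (- |v|) decrease. Both facts are kept together
    because they concern the same [m]. *)
Lemma laplace_conv (mu nu : {finite_measure set rT -> \bar R}) :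
  exists m : {finite_measure set rT -> \bar R},
    (forall s, 0 <= s -> (\int[m]_v (expR (- (s * `|v|)))%:E =
      \int[mu]_v (expR (- (s * `|v|)))%:E * \int[nu]_v (expR (- (s * `|v|)))%:E)%E) /\
    (nu setT = 1%E -> forall x : R,
      (m [set v | (x < expR (- `|v|))%R] <= mu [set v | (x < expR (- `|v|))%R])%E).
Proof.
pose phi (p : rT * rT) : rT := `|p.1| + `|p.2|.
have mphi : measurable_fun setT phi.
  by apply: measurable_funD; apply: measurableT_comp.
have [m' [m'A m'E]] := pushforward_exists (mu \x nu)%E mphi.
have [|m mE] := @finite_measure_exists m'.
  rewrite m'A preimage_setT -setXTT [ltLHS]product_measure1E//.
  by rewrite lte_mul_pinfty// ?fin_num_measure// -ge0_fin_numE// fin_num_measure.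
exists m; split => [s s0|nuT x].
  transitivity (\int[m']_v (expR (- (s * `|v|)))%:E)%E.
    by apply: eq_measure_integral => A _ _; exact: mE.
  rewrite m'E//; last exact: measurable_laplace_kernel.
  rewrite fubini_tonelli1//; last first.
    exact: (measurableT_comp (measurable_laplace_kernel s) mphi).
  rewrite /fubini_F -(ge0_integralZr _ _ (measurable_laplace_kernel s))//; last first.
    by apply: integral_ge0 => w _; rewrite lee_fin expR_ge0.
  apply: eq_integral => v _.
  rewrite -(ge0_integralZl _ _ (measurable_laplace_kernel s)) ?lee_fin ?expR_ge0//.
  apply: eq_integral => w _.
  by rewrite /phi/= ger0_norm ?addr_ge0// mulrDr opprD expRD EFinM.
have mt := measurable_tail_set x.
rewrite mE m'A.
rewrite -[leRHS]mule1 -nuT -[leRHS](product_measure1E mu nu mt measurableT).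
apply: le_measure; rewrite ?inE.
- by rewrite -[X in measurable X]setTI; exact: mphi.
- exact: measurableX.
- move=> [v w]/= xv; split => //=; apply: lt_le_trans xv _.
  by rewrite /phi/= ler_expR lerN2 [leRHS]ger0_norm ?addr_ge0// lerDl.
Qed.

Lemma laplace_rep_mul (h g : R -> R) : laplace_rep h -> laplace_rep g ->
  laplace_rep (fun s => h s * g s).
Proof.
move=> [mu muE] [nu nuE]; have [m [mE _]] := laplace_conv mu nu.
by exists m => s s0; rewrite mE// muE// nuE// EFinM.
Qed.

Lemma laplace_rep_exp (h : R -> R) n : laplace_rep h ->
  laplace_rep (fun s => h s ^+ n).
Proof.
move=> hh; elim: n => [|n ih]; first exact: laplace_rep_cst.
apply: (laplace_rep_ext _ (laplace_rep_mul hh ih)) => s _.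
by rewrite exprS.
Qed.

Lemma laplace_rep_prod (I : Type) (r : seq I) (h : I -> R -> R) :
  (forall i, laplace_rep (h i)) -> laplace_rep (fun s => \prod_(i <- r) h i s).
Proof.
move=> hh; elim: r => [|i r ih].
  by apply: (laplace_rep_ext _ (laplace_rep_cst ler01)) => s _; rewrite big_nil.
apply: (laplace_rep_ext _ (laplace_rep_mul (hh i) ih)) => s _.
by rewrite big_cons.
Qed.

(** The representing measure is the countable sum; its finiteness comes from the real limit at
    [s = 0]. *)
Lemma laplace_rep_series (h : nat -> R -> R) (g : R -> R) :
  (forall n, laplace_rep (h n)) ->
  (forall s, 0 <= s -> series (fun n => h n s) @ \oo --> g s) ->
  laplace_rep g.
Proof.
move=> hh gE; have [mu muE] := choice hh.
apply: (@laplace_rep_measure _ (mseries (fun n => mu n : {measure set rT -> \bar R}) 0)) => s s0.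
rewrite ge0_integral_measure_series//; last exact: measurable_laplace_kernel.
under eq_eseriesr do rewrite muE//.
apply/cvg_lim => //; under eq_fun do rewrite sumEFin.
apply: cvg_EFin; first exact: nearW.
exact: gE.
Qed.

(** For u uniform on [0, 1], |ln u| / b is exponential with rate b and has transform 1 / (s / b +
    1); dividing by b gives the claim. *)
Lemma laplace_rep_inv (b : R) : 0 < b -> laplace_rep (fun s => (s + b)^-1).
Proof.
move=> b0.
pose U : {measure set rT -> \bar R} := uniform_prob (@ltr01 R).
have mphi : measurable_fun [set: rT] (fun u : rT => ln u / b : rT).
  by apply: measurable_funM => //; exact: measurable_ln.
have [m [_ mE]] := pushforward_exists U mphi.
suff h : laplace_rep (fun s => (s / b + 1)^-1).
  have b0' : 0 <= b^-1 by rewrite invr_ge0 ltW.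
  apply: (laplace_rep_ext _ (laplace_rep_mul (laplace_rep_cst b0') h)).
  by move=> s s0; field; rewrite !gt_eqF//; lra.
apply: (@laplace_rep_measure _ m) => s s0.
have sb0 : 0 <= s / b by rewrite divr_ge0// ltW.
have sb1 : 0 < s / b + 1 by lra.
rewrite mE//; last exact: measurable_laplace_kernel.
rewrite integral_uniform//; last exact: (measurableT_comp (measurable_laplace_kernel s) mphi).
rewrite subr0 invr1 mul1e.
(* exp (- s |ln u| / b) = u^(s / b) for 0 < u <= 1; the endpoint 0, where [ln] takes a default
   value, is removed first. *)
have eqv : (\int[lebesgue_measure]_(u in `[0%R, 1%R]) (expR (- (s * `|ln u / b|)))%:E =
            \int[lebesgue_measure]_(u in `[0%R, 1%R]) (u `^ (s / b))%:E)%E.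
  rewrite -[RHS]integral_itv_obnd_cbnd; last by apply/measurable_EFinP/measurable_funTS.
  rewrite -[LHS]integral_itv_obnd_cbnd; last first.
    apply: measurable_funTS.
    exact: (measurableT_comp (measurable_laplace_kernel s) mphi).
  apply: eq_integral => u; rewrite inE/= in_itv/= => /andP[u0 u1].
  rewrite /powR gt_eqF// ler0_norm ?mulr_le0_ge0 ?ln_le0 ?invr_ge0// ?ltW//.
  by congr (expR _)%:E; ring.
rewrite eqv.
have := @integral_powR _ _ 1 sb0 ltr01; rewrite powR1.
under eq_integral do rewrite EFinM.
rewrite ge0_integralZl//; last 3 first.
  by apply/measurable_EFinP/measurable_funTS.
  by move=> u _; rewrite lee_fin powR_ge0.
  by rewrite lee_fin ltW.
move=> /(congr1 (fun x => ((s / b + 1)^-1)%:E * x)%E).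
by rewrite muleA -EFinM mulVf ?gt_eqF// mul1e mule1.
Qed.


(** The remainder after n terms vanishes at 0 and has derivative y^n / (1 - y), so the mean value
    theorem bounds it. *)
Lemma ln_series_rem (x : R) n : 0 <= x < 1 ->
  0 <= - ln (1 - x) - \sum_(i < n) x ^+ i.+1 / i.+1%:R <= x ^+ n / (1 - x).
Proof.
move=> /andP[]; rewrite le_eqVlt => /predU1P[<- _|x0 x1].
  rewrite subr0 ln1 oppr0 big1 ?subr0 ?lexx ?divr_ge0 ?exprn_ge0//.
  by move=> i _; rewrite expr0n mul0r.
pose f m (y : R) := - ln (1 - y) - \sum_(i < m) y ^+ i.+1 / i.+1%:R.
have df m (y : R) : y < 1 -> is_derive y (1 : R) (f m) (y ^+ m / (1 - y)).
  move=> y1; have y1' : 0 < 1 - y by lra.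
  elim: m => [|m ih].
    have -> : f 0%N = - (@ln R \o (cst 1 - id)).
      by apply/funext => t; rewrite /f big_ord0 subr0.
    apply: is_derive_eq.
      apply: is_deriveN; apply: is_derive1_comp.
      exact: is_derive1_ln.
    by rewrite /= sub0r mulrN1 opprK expr0 mul1r.
  have -> : f m.+1 = f m - (m.+1%:R^-1 \*: (id ^+ m.+1 : R -> R)).
    apply/funext => t; rewrite /f big_ord_recr/= opprD addrA; congr (_ - _).
    by rewrite !fctE mulrC.
  apply: is_derive_eq.
  rewrite /= !scaler1 exprS scalerA mulVf ?pnatr_eq0// scale1r.
  by field; rewrite gt_eqF.
have [y||c] := @MVT R (f n) (fun y => y ^+ n / (1 - y)) 0 x x0.
- by rewrite in_itv/= => /andP[_ yx]; apply: df; lra.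
- apply: derivable_within_continuous => y; rewrite in_itv/= => /andP[_ yx].
  by have [] := df n y (le_lt_trans yx x1).
rewrite in_itv/= => /andP[c0 cx].
have -> : f n 0 = 0.
  rewrite /f subr0 ln1 oppr0 big1 ?subr0// => i _; by rewrite expr0n mul0r.
rewrite !subr0 -/(f n x) => ->.
have c1 : 0 < 1 - c by lra.
have cn := exprn_ge0 n (ltW c0).
have xn : c ^+ n <= x ^+ n by rewrite lerXn2r// ?nnegrE; exact: ltW.
rewrite !mulr_ge0 ?invr_ge0//=; [|exact: ltW..].
(* Since c < x < 1, x (1 - x) <= 1 - x <= 1 - c. *)
have step : x / (1 - c) <= (1 - x)^-1.
  rewrite ler_pdivrMr// ler_pdivlMl; last lra.
  nra.
rewrite -mulrA [_^-1 * x]mulrC.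
apply: ler_pM => //; rewrite divr_ge0//; exact: ltW.
Qed.

Lemma ln_series (x : R) : 0 <= x < 1 ->
  series (fun i => x ^+ i.+1 / i.+1%:R) @ \oo --> - ln (1 - x).
Proof.
move=> x01; have /andP[x0 x1] := x01.
apply: (@squeeze_cvgr _ _ _ _ (fun n => - ln (1 - x) - x ^+ n / (1 - x)) (cst (- ln (1 - x)))).
- near=> n; have /andP[] := ln_series_rem n x01.
  by rewrite /series/= big_mkord; lra.
- rewrite -[X in _ --> X]subr0; apply: cvgB; first exact: cvg_cst.
  rewrite -[X in _ --> X](mul0r (1 - x)^-1); apply: cvgMr_tmp.
  by apply: cvg_expr; rewrite ger0_norm.
- exact: cvg_cst.
Unshelve. all: end_near. Qed.

Lemma expR_series (x : R) : series (fun n => x ^+ n / n`!%:R) @ \oo --> expR x.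
Proof. exact: (@is_cvg_series_exp_coeff R x). Qed.

Lemma laplace_rep_scale (r : R) (h : R -> R) : 0 <= r -> laplace_rep h ->
  laplace_rep (fun s => r * h s).
Proof. by move=> /laplace_rep_cst; exact: laplace_rep_mul. Qed.

Lemma laplace_rep_expR (h : R -> R) : laplace_rep h ->
  laplace_rep (fun s => expR (h s)).
Proof.
move=> hh.
apply: (@laplace_rep_series (fun n s => n`!%:R^-1 * h s ^+ n)).
  by move=> n; apply: laplace_rep_scale; [rewrite invr_ge0|exact: laplace_rep_exp].
move=> s _; have := @expR_series (h s).
by under [X in series X]eq_fun do rewrite mulrC.
Qed.

Lemma laplace_rep_ln_ratio (a b : R) : 0 < a <= b ->
  laplace_rep (fun s => ln ((s + b) / (s + a))).
Proof.
move=> /andP[a0 ab]; have b0 : 0 < b by lra.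
pose x s := (b - a) * (s + b)^-1.
have hx : laplace_rep x.
  by apply: laplace_rep_scale; [rewrite subr_ge0|exact: laplace_rep_inv].
apply: (@laplace_rep_series (fun n s => n.+1%:R^-1 * x s ^+ n.+1)).
  by move=> n; apply: laplace_rep_scale; [rewrite invr_ge0|exact: laplace_rep_exp].
move=> s s0.
have sa : 0 < s + a by lra.
have sb : 0 < s + b by lra.
have x01 : 0 <= x s < 1.
  rewrite mulr_ge0 ?invr_ge0 ?subr_ge0//=; last exact: ltW.
  by rewrite ltr_pdivrMr// mul1r; lra.
have -> : ln ((s + b) / (s + a)) = - ln (1 - x s).
  rewrite -lnV ?posrE; last by have := x01; lra.
  by congr ln; rewrite /x; field; rewrite !gt_eqF//=; lra.
have := ln_series x01.
by under [X in series X]eq_fun do rewrite mulrC.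
Qed.

(** The ratio is (a / b) ((s + b) / (s + a)), and the c-th power of the second factor is the
    exponential of c times its logarithm. *)
Lemma laplace_rep_ratio_powR (a b c : R) : 0 < a <= b -> 0 <= c ->
  laplace_rep (fun s => ((1 + s / b) / (1 + s / a)) `^ c).
Proof.
move=> ab c0; have /andP[a0 ab'] := ab; have b0 : 0 < b by lra.
have h := laplace_rep_scale (powR_ge0 (a / b) c)
  (laplace_rep_expR (laplace_rep_scale c0 (laplace_rep_ln_ratio ab))).
apply: (laplace_rep_ext _ h) => s s0.
have sa : 0 < s + a by lra.
have sb : 0 < s + b by lra.
have -> : (1 + s / b) / (1 + s / a) = (a / b) * ((s + b) / (s + a)).
  by field; rewrite !gt_eqF//=; lra.
rewrite [RHS]powRM ?divr_ge0 ?ltW//.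
by congr (_ * _); rewrite /powR gt_eqF// divr_gt0.
Qed.

End laplace.

(** * Quantile coupling of decreasing laws *)

Section quantile.
Context {R : realType}.
Notation rT := (measurableTypeR R).

(** Open upper rays form a pi-system generating the Borel sets, and the rays from -n exhaust the
    line with finite mass. *)
Lemma measure_eq_rays (m1 m2 : {measure set rT -> \bar R}) :
  (m1 setT < +oo)%E ->
  (forall x : R, m1 `]x, +oo[%classic = m2 `]x, +oo[%classic) ->
  forall A : set rT, measurable A -> m1 A = m2 A.
Proof.
move=> fin1 eq12 A mA.
pose G : set (set R) := [set B | exists x : R, B = `]x, +oo[%classic].
apply: (@measure_unique _ R rT G (fun n => `](- n%:R)%R, +oo[%classic)) => //.
- have := @measurable_realfun.RGenOInfty.measurableE R.
  exact.
- move=> _ _ [x ->] [y ->]; exists (Num.max x y).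
  by rewrite predeqE => z /=; rewrite !in_itv/= !andbT gt_max; split => [[-> ->]|/andP].
- by move=> i; exists (- i%:R).
- rewrite predeqE => x; split => // _.
  exists (Num.truncn `|x|).+1 => //=; rewrite in_itv/= andbT ltrNl.
  by apply: le_lt_trans (truncnS_gt _); rewrite -normrN ler_norm.
- by move=> _ [x ->].
- move=> n; apply: le_lt_trans fin1; apply: le_measure; rewrite ?inE//.
Qed.

(** The generalized inverse of a tail function [G]. Adjoining 0 keeps the set nonempty, so [sup]
    never takes its default value. *)
Definition quantile (G : R -> \bar R) (u : R) : R :=
  sup [set x | x = 0 \/ (0 <= x <= 1 /\ (u%:E < G x)%E)].

Lemma quantile_has_sup (G : R -> \bar R) (u : R) :
  has_sup [set x | x = 0 \/ (0 <= x <= 1 /\ (u%:E < G x)%E)].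
Proof.
split; first by exists 0; left.
by exists 1 => x [->//|[/andP[]]].
Qed.

Lemma quantile01 G u : 0 <= quantile G u <= 1.
Proof.
apply/andP; split.
  by apply: sup_upper_bound; [exact: quantile_has_sup|left].
apply: ge_sup; first by exists 0; left.
by move=> x [->//|[/andP[]]].
Qed.

Lemma le_quantile (G G' : R -> \bar R) u : (forall x, G x <= G' x)%E ->
  quantile G u <= quantile G' u.
Proof.
move=> GG'; apply: sup_le; [|by exists 0; left|exact: quantile_has_sup].
move=> x Sx; exists x; split => //.
by case: Sx => [->|[x01 uG]]; [left|right; split => //; exact: lt_le_trans uG _].
Qed.

Lemma quantile_nonincreasing (G : R -> \bar R) :
  {homo quantile G : u v /~ v <= u}.
Proof.
move=> v u uv; apply: sup_le; [|by exists 0; left|exact: quantile_has_sup].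
move=> x Sx; exists x; split => //.
case: Sx => [->|[x01 uG]]; [by left|right; split => //].
by apply: le_lt_trans uG; rewrite lee_fin.
Qed.

(** Right continuity supplies a point z > x with u < G z, and the vanishing of [G] from 1 on places
    z in [0, 1], hence below the supremum; this makes the equivalence strict. *)
Lemma quantile_gt (G : R -> \bar R) (u x : R) :
  (forall y z : R, y <= z -> (G z <= G y)%E) ->
  (forall y, (u%:E < G y)%E -> exists2 z, y < z & (u%:E < G z)%E) ->
  (forall y : R, 1 <= y -> G y = 0%E) ->
  0 <= u -> 0 <= x -> (x < quantile G u) = (u%:E < G x)%E.
Proof.
move=> Gdec Grc G1 u0 x0; apply/idP/idP.
  move=> /sup_gt[|y [->|[_ uG]] xy]; first by exists 0; left.
    by move: xy; rewrite ltNge x0.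
  by apply: lt_le_trans uG _; exact/Gdec/ltW.
move=> /Grc[z xz uz]; apply: (lt_le_trans xz).
apply: sup_upper_bound; first exact: quantile_has_sup.
right; split => //; rewrite (le_trans x0 (ltW xz))/=.
rewrite leNgt; apply/negP => /ltW/G1 z0.
by move: uz; rewrite z0 lte_fin ltNge u0.
Qed.

Let U : probability rT R := uniform_prob (@ltr01 R).

Lemma uniform01E (A : set rT) : measurable A ->
  U A = lebesgue_measure (A `&` `[0%R, 1%R]%classic).
Proof.
move=> mA; rewrite -integral_indic// -[LHS]mul1e.
transitivity (\int[U]_x (\1_A x)%:E)%E.
  by rewrite integral_indic// setIT mul1e.
rewrite integral_uniform ?subr0 ?invr1 ?mul1e//.
exact/measurable_EFinP/measurable_indic.
Qed.

(** The tail function of X = exp (- |v|); the strict inequality makes it right continuous. *)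
Definition tail (mu : set rT -> \bar R) (x : R) : \bar R :=
  mu [set v : rT | (x < expR (- `|v|))%R].

(** Continuity from below along the thresholds x + 1 / (n + 1), which decrease to x. *)
Lemma tail_right_cont (mu : {measure set rT -> \bar R}) (u x : R) :
  (u%:E < tail mu x)%E -> exists2 z, x < z & (u%:E < tail mu z)%E.
Proof.
move=> ux.
pose F n : set rT := [set v : rT | (x + n.+1%:R^-1 < expR (- `|v|))%R].
have FE : \bigcup_n F n = [set v : rT | (x < expR (- `|v|))%R].
  rewrite predeqE => v; split => [[n _]/=|/= xv].
    by apply: lt_trans; rewrite ltrDl.
  exists (Num.truncn ((expR (- `|v|) - x)^-1)) => //=.
  rewrite /F/= -ltrBrDl invf_plt ?posrE ?subr_gt0//.
  exact: truncnS_gt.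
have cv : mu \o F @ \oo --> tail mu x.
  rewrite /tail -FE; apply: nondecreasing_cvg_mu.
  - by move=> n; exact: measurable_tail_set.
  - by rewrite FE; exact: measurable_tail_set.
  - move=> m n mn; apply/subsetPset => v /=; apply: le_lt_trans.
    by rewrite lerD2l lef_pV2 ?posrE// ler_nat ltnS.
apply: contrapT => nex; move: ux; rewrite ltNge => /negP; apply.
rewrite -(cvg_lim _ cv)//; apply: lime_le; first by apply/cvg_ex; exists (tail mu x).
apply: nearW => n; rewrite leNgt; apply/negP => un; apply: nex.
by exists (x + n.+1%:R^-1) => //; rewrite ltrDl.
Qed.

(** Inverse transform sampling: under the uniform law the quantile function has the law of exp (-
    |v|). The two pushforwards are compared on rays. *)
Lemma quantile_law (mu : {measure set rT -> \bar R}) (f : rT -> \bar R) :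
  mu setT = 1%E -> measurable_fun setT f -> (forall x, 0 <= f x)%E ->
  (\int[U]_u f (quantile (tail mu) u) = \int[mu]_v f (expR (- `|v|)))%E.
Proof.
move=> muT mf f0.
have mq : measurable_fun [set: rT] (quantile (tail mu) : rT -> rT).
  by apply: nonincreasing_measurable => //; exact: quantile_nonincreasing.
have [m1 [m1A m1E]] := pushforward_exists U mq.
have [m2 [m2A m2E]] := @pushforward_exists _ _ rT rT _ mu _ measurable_expRN_norm.
transitivity (\int[m1]_y f y)%E; first by rewrite m1E.
transitivity (\int[m2]_y f y)%E; last by rewrite m2E.
apply: eq_measure_integral => A mA _; apply: measure_eq_rays mA => [|x].
  by rewrite m1A preimage_setT [ltLHS]probability_setT ltry.
rewrite m1A m2A.
(* Both variables are nonnegative, so a ray from a negative point has mass 1 on each side. *)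
have [x0|x0] := ltP x 0.
  have -> : quantile (tail mu) @^-1` `]x, +oo[%classic = setT.
    rewrite predeqE => u; split => // _ /=; rewrite in_itv/= andbT.
    by apply: lt_le_trans x0 _; case/andP: (quantile01 (tail mu) u).
  have -> : (fun v : R => expR (- `|v|)) @^-1` `]x, +oo[%classic = setT.
    rewrite predeqE => u; split => // _ /=; rewrite in_itv/= andbT.
    by apply: lt_trans x0 _; exact: expR_gt0.
  by rewrite muT; exact: probability_setT.
have tail1 y : (tail mu y <= 1)%E.
  by rewrite -muT; apply: le_measure; rewrite ?inE//; exact: measurable_tail_set.
have tailfin y : tail mu y \is a fin_num.
  rewrite ge0_fin_numE; last exact: measure_ge0.
  by apply: le_lt_trans (tail1 y) _; rewrite ltry.
have -> : (fun v : R => expR (- `|v|)) @^-1` `]x, +oo[%classic =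
    [set v : rT | (x < expR (- `|v|))%R].
  by rewrite predeqE => v /=; rewrite in_itv/= andbT.
rewrite -/(tail mu x) [LHS]uniform01E; last first.
  by rewrite -[X in measurable X]setTI; apply: mq.
(* [quantile_gt] turns the event into an interval of length [tail mu x]. *)
have -> : (quantile (tail mu) @^-1` `]x, +oo[%classic) `&` `[0%R, 1%R]%classic =
    `[0%R, fine (tail mu x)[%classic :> set R.
  have qgt u : 0 <= u -> (x < quantile (tail mu) u) = (u%:E < tail mu x)%E.
    move=> u0; apply: quantile_gt => //.
    + move=> y z yz; apply: le_measure; rewrite ?inE; try exact: measurable_tail_set.
      by move=> v /=; exact: le_lt_trans.
    + by move=> y; exact: tail_right_cont.
    + move=> y y1; rewrite /tail (_ : mkset _ = set0) ?measure0//.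
      rewrite predeqE => v; split => //=; apply/negP; rewrite -leNgt.
      by apply: le_trans y1; rewrite expR_le1 oppr_le0.
  rewrite predeqE => u /=; rewrite !in_itv/= andbT; split.
    by move=> [+ /andP[u0 _]]; rewrite qgt// u0/= -lte_fin fineK.
  move=> /andP[u0]; rewrite -lte_fin fineK// => ut; split; first by rewrite qgt.
  by rewrite u0/= -lee_fin; apply: le_trans (tail1 x); exact: ltW.
rewrite lebesgue_measure_itv/= lte_fin; case: ifPn => [_|].
  by rewrite sube0 fineK.
rewrite -leNgt => t0; apply/esym/eqP; rewrite -(fineK (tailfin x)) eqe eq_le t0/=.
by apply: fine_ge0; exact: measure_ge0.
Qed.

(** Working with X in [0, 1] instead of V keeps the limit a genuine variable: mass escaping to V =
    +oo would appear as mass at [q u = 0]. *)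
Lemma laplace_rep_prod_limit (h : nat -> R -> R) (H : R -> R) :
  (forall i, laplace_rep (h i)) -> (forall i, h i 0 = 1) ->
  (forall s, 0 <= s -> \prod_(i < n) h i s @[n --> \oo] --> H s) ->
  exists q : rT -> rT, [/\ measurable_fun setT q, (forall u, 0 <= q u <= 1) &
    forall s, 0 <= s -> (\int[U]_u (q u `^ s)%:E = (H s)%:E)%E].
Proof.
move=> hh h0 hH.
have [rho rhoE] := choice hh.
have rhoT i : rho i setT = 1%E.
  rewrite -(h0 i) -rhoE//.
  under eq_integral do rewrite mul0r oppr0 expR0.
  by rewrite integral_cst// mul1e.
have [conv convE] := choice (fun p : {finite_measure set rT -> \bar R} *
  {finite_measure set rT -> \bar R} => laplace_conv p.1 p.2).
have [mu0 mu0E] := laplace_rep_cst (@ler01 R).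
(* Laws of the partial sums: start from [mu0], whose transform is 1, and convolve successively with
   [rho n]. *)
pose mu_ := nat_rect (fun=> {finite_measure set rT -> \bar R}) mu0
  (fun n m => conv (m, rho n)).
have mu_E n s : 0 <= s ->
    (\int[mu_ n]_v (expR (- (s * `|v|)))%:E = (\prod_(i < n) h i s)%:E)%E.
  move=> s0; elim: n => [|n ih]; first by rewrite big_ord0 mu0E.
  by rewrite /= (convE (mu_ n, rho n)).1// ih rhoE// big_ord_recr.
have mu_T n : mu_ n setT = 1%E.
  have := mu_E n 0 (lexx _); rewrite big1//.
  under eq_integral do rewrite mul0r oppr0 expR0.
  by rewrite integral_cst// mul1e.
pose Q n := quantile (tail (mu_ n)).
(* Convolution with a probability lowers the tail, hence the quantile at every [u]: the laws are
   coupled as a pointwise monotone sequence. *)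
have Qdec u : nonincreasing_seq (Q^~ u).
  apply/nonincreasing_seqP => n; apply: le_quantile => x.
  by apply: (convE (mu_ n, rho n)).2; exact: rhoT.
have Q01 n u : 0 <= Q n u <= 1 by exact: quantile01.
pose q u := inf (range (Q^~ u)).
have Qq u : Q n u @[n --> \oo] --> q u.
  apply: nonincreasing_cvgn; first exact: Qdec.
  by exists 0 => _ [n _ <-]; case/andP: (Q01 n u).
have mQ n : measurable_fun [set: rT] (Q n : rT -> rT).
  by apply: nonincreasing_measurable => //; exact: quantile_nonincreasing.
have q01 u : 0 <= q u <= 1.
  apply/andP; split.
    apply: lb_le_inf; first by exists (Q 0%N u); exists 0%N.
    by move=> _ [n _ <-]; case/andP: (Q01 n u).
  have /andP[_] := Q01 0%N u; apply: le_trans.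
  apply: ge_inf; last by exists 0%N.
  by exists 0 => _ [n _ <-]; case/andP: (Q01 n u).
exists q; split => //.
  by apply: (measurable_fun_cvg (h := Q)) => // u _; exact: Qq.
move=> s s0.
(* The limit of [a] is computed twice: by dominated convergence with bound 1, and as the limit of
   the partial products. *)
pose a n := (\int[U]_u (Q n u `^ s)%:E)%E.
have aE : a = EFin \o (fun n => \prod_(i < n) h i s).
  apply/funext => n /=; rewrite -mu_E//.
  rewrite /a (@quantile_law (mu_ n) (fun x => (x `^ s)%:E))//.
  - by apply: eq_integral => v _; rewrite -expRM mulNr mulrC.
  - exact: mu_T.
  - exact/measurable_EFinP.
  - by move=> x; rewrite lee_fin powR_ge0.
have cv : a @ \oo --> (\int[U]_u (q u `^ s)%:E)%E.
  apply: (@dominated_cvg _ _ _ U setT measurableT (fun n u => (Q n u `^ s)%:E)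
    (fun u => (q u `^ s)%:E) (cst 1%E)) => //=.
  - by move=> n; apply/measurable_EFinP; exact: (measurableT_comp (measurable_powR s) (mQ n)).
  - move=> u _; apply: cvg_EFin; first exact: nearW.
    move: s0; rewrite le_eqVlt => /predU1P[<-|s0].
      by rewrite powRr0; under eq_fun do rewrite powRr0; exact: cvg_cst.
    by apply: powR_cvg_seq => // n; case/andP: (Q01 n u).
  - apply/integrableP; split => //.
    by rewrite /= normr1 integral_cst// mul1e [ltLHS]probability_setT ltry.
  - move=> n u _; rewrite lee_fin ger0_norm ?powR_ge0//.
    have /andP[Q0 Q1] := Q01 n u.
    have := @ge0_ler_powR _ _ s0 (Q n u) 1.
    by rewrite !nnegrE Q0 ler01 powR1; apply.
have cv' : a @ \oo --> (H s)%:E.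
  by rewrite aE; apply: cvg_EFin; [exact: nearW|exact: hH].
exact: cvg_unique cv cv'.
Qed.

End quantile.

(** * Euler's product for the Gamma function *)

Section gamma.
Context {R : realType}.
Notation leb := (@lebesgue_measure R).
Implicit Types (z s t x : R) (n m : nat).

(* [Gamma (z + 1)] as an extended real, so that Tonelli's theorem can be used
   before the integral is known to be finite. *)
Definition egamma1 z : \bar R :=
  (\int[leb]_(x in `[0%R, +oo[) (x `^ z * expR (- x))%:E)%E.

Lemma measurable_gamma_integrand z :
  measurable_fun [set: measurableTypeR R]
    (fun x : measurableTypeR R => (x `^ z * expR (- x))%:E).
Proof.
apply/measurable_EFinP; apply: measurable_funM => //.
by apply: measurableT_comp => //; exact: measurable_funN.
Qed.

Lemma gamma_integrand_ge0 z x : (0 <= (x `^ z * expR (- x))%:E)%E.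
Proof. by rewrite lee_fin mulr_ge0 ?powR_ge0 ?expR_ge0. Qed.

Lemma GammaE z : Gamma (z + 1) = fine (egamma1 z).
Proof.
rewrite /Gamma /Rintegral addrK /egamma1; congr fine.
apply: integral_itv_obnd_cbnd.
exact: (measurable_funTS (measurable_gamma_integrand z)).
Qed.

Lemma integral_expRN_ray x : 0 <= x ->
  (\int[leb]_(t in `[x, +oo[) (expR (- t))%:E = (expR (- x))%:E)%E.
Proof.
move=> x0.
have cexp : continuous (fun t : R => expR (- t)).
  by move=> t; apply: continuous_comp; [exact: continuousN|exact: continuous_expR].
rewrite (@ge0_continuous_FTC2y _ _ (fun t => - expR (- t)) _ 0)//.
- by rewrite EFinN oppeK add0e.
- exact: continuous_subspaceT.
- by rewrite -oppr0; apply: cvgN; exact: cvgr_expR.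
- by apply: cvgN; apply: cvg_at_right_filter; exact: cexp.
- move=> t _; rewrite derive1E.
  have h : is_derive t (1 : R) (- (@expR R \o -%R)) (- (expR (- t) * -1)).
    by apply: is_deriveN; apply: is_derive1_comp.
  by rewrite (_ : (fun t => - expR (- t)) = - (@expR R \o -%R))// derive_val mulrN1 opprK.
Qed.

(* Tonelli applied to [(z + 1) x^z exp(-t)] on the wedge [0 <= x <= t]. *)
Lemma egamma1S z : 0 <= z -> egamma1 (z + 1) = ((z + 1)%:E * egamma1 z)%E.
Proof.
move=> z0; have z1 : 0 < z + 1 by lra.
pose f (p : measurableTypeR R * measurableTypeR R) : \bar R :=
  (\1_[set p : measurableTypeR R * measurableTypeR R | ((0 <= p.1) && (p.1 <= p.2))%R] p *
   ((z + 1) * p.1 `^ z * expR (- p.2)))%:E.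
have mf : measurable_fun setT f.
  apply/measurable_EFinP; apply: measurable_funM.
    apply: measurable_indic.
    have m : measurable_fun setT (fun p : measurableTypeR R * measurableTypeR R =>
        (0 <= p.1)%R && (p.1 <= p.2)%R).
      by apply: measurable_and; apply: measurable_fun_ler.
    by have := m measurableT [set true]; rewrite setTI; apply.
  apply: measurable_funM.
    apply: measurable_funM => //.
    by apply: (measurableT_comp (measurable_powR z)).
  by apply: measurableT_comp => //; apply: measurable_funN.
have f0 p : (0 <= f p)%E.
  by rewrite lee_fin !mulr_ge0 ?powR_ge0 ?expR_ge0// ltW.
have := @fubini_tonelli _ _ _ _ R leb leb f mf f0.
(* Integrating first over y in [x, +oo[ leaves exp (- x). *)
have -> : (\int[leb]_x \int[leb]_y f (x, y) = (z + 1)%:E * egamma1 z)%E.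
  have mg : measurable_fun (`[0%R, +oo[%classic : set (measurableTypeR R))
      (fun x : measurableTypeR R => (x `^ z * expR (- x))%:E).
    by apply: measurable_funTS; exact: measurable_gamma_integrand.
  rewrite /egamma1 -(ge0_integralZl _ _ mg)//; last 2 first.
  - by move=> x _; exact: gamma_integrand_ge0.
  - by rewrite lee_fin ltW.
  rewrite [RHS]integral_mkcond; apply: eq_integral => x _; rewrite patchE; case: ifPn.
    rewrite inE/= in_itv/= andbT => x0.
    transitivity (\int[leb]_(y in `[x, +oo[) (((z + 1) * x `^ z)%:E * (expR (- y))%:E))%E.
      rewrite [RHS]integral_mkcond; apply: eq_integral => y _.
      rewrite patchE /f indicE/=; case: ifPn.
        by rewrite inE/= in_itv/= andbT => xy; rewrite mem_set/= ?x0 ?xy// mul1r EFinM.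
      rewrite notin_setE/= in_itv/= andbT => xy.
      by rewrite memNset ?mul0r//= => /andP[_ ?]; exact: xy.
    have me : measurable_fun (`[x, +oo[%classic : set (measurableTypeR R))
        (fun y : measurableTypeR R => (expR (- y))%:E).
      apply/measurable_EFinP/measurable_funTS.
      by apply: (measurableT_comp (@measurable_expR R)); exact: measurable_funN.
    rewrite (ge0_integralZl _ _ me) ?lee_fin ?mulr_ge0 ?powR_ge0 ?(ltW z1)//.
    by rewrite integral_expRN_ray// -!EFinM mulrA.
  rewrite notin_setE/= in_itv/= andbT => x0; apply: integral0_eq => y _.
  rewrite /f indicE memNset ?mul0r//= => /andP[].
  by move=> ? _; exact: x0.
(* Integrating first over x in [0, y] leaves y^(z + 1) when y > 0. *)
have -> : (\int[leb]_y \int[leb]_x f (x, y) = egamma1 (z + 1))%E.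
  rewrite /egamma1 [RHS]integral_mkcond; apply: eq_integral => y _.
  have inner : 0 < y -> (\int[leb]_x f (x, y) = (y `^ (z + 1) * expR (- y))%:E)%E.
    move=> y0.
    transitivity (\int[leb]_(x in `[0%R, y]) (((z + 1) * x `^ z)%:E * (expR (- y))%:E))%E.
      rewrite [RHS]integral_mkcond; apply: eq_integral => x _.
      rewrite patchE /f indicE/=; case: ifPn.
        by rewrite inE/= in_itv/= => xy; rewrite mem_set/= ?xy// mul1r EFinM.
      rewrite notin_setE/= in_itv/= => xy; rewrite memNset/= ?mul0r//.
    have me : measurable_fun (`[0%R, y]%classic : set (measurableTypeR R))
        (fun x : measurableTypeR R => ((z + 1) * x `^ z)%:E).
      apply/measurable_EFinP/measurable_funTS; apply: measurable_funM => //.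
    rewrite (ge0_integralZr _ _ me) ?lee_fin ?expR_ge0//; last first.
      by move=> x _; rewrite lee_fin mulr_ge0 ?powR_ge0// ltW.
    by rewrite integral_powR// EFinM.
  rewrite patchE; case: ifPn.
    rewrite inE/= in_itv/= andbT le_eqVlt => /predU1P[<-|//].
    rewrite powR0 ?gt_eqF// mul0r.
    rewrite integral_mkcond/= (_ : (\int[leb]_x _)%E =
      (\int[leb]_(x in [set 0%R]) (((z + 1) * x `^ z)%:E))%E).
      by rewrite integral_set1.
    rewrite [RHS]integral_mkcond; apply: eq_integral => x _.
    rewrite !patchE /f indicE/= in_setT oppr0 expR0 mulr1; case: ifPn.
      by rewrite inE/= => ->; rewrite mem_set/= ?lexx// mul1r.
    rewrite notin_setE/= => x0; rewrite memNset ?mul0r//= => /andP[a b].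
    by apply: x0; apply/eqP; rewrite eq_le a b.
  rewrite notin_setE/= in_itv/= andbT => /negP; rewrite -ltNge => y0.
  apply: integral0_eq => x _; rewrite /f indicE memNset ?mul0r//= => /andP[a b].
  by move: y0; rewrite ltNge (le_trans a b).
by move=> <-.
Qed.

Lemma egamma1_0 : egamma1 0 = 1%E.
Proof.
rewrite /egamma1; under eq_integral do rewrite powRr0 mul1r.
by rewrite integral_expRN_ray// oppr0 expR0.
Qed.

Lemma egamma1_nat n : egamma1 n%:R = (n`!%:R)%:E.
Proof.
elim: n => [|n ih]; first by rewrite egamma1_0.
by rewrite -natr1 egamma1S ?ler0n// ih -EFinM natr1 -natrM -factS.
Qed.

Lemma egamma1_ge0 z : (0 <= egamma1 z)%E.
Proof. by apply: integral_ge0 => x _; exact: gamma_integrand_ge0. Qed.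

(** Integrates an inequality between powers against exp (- t); the bounds on Gamma below all arise
    this way. Dropping the endpoint leaves only t > 0 to check. *)
Lemma le_egamma1 (c0 c1 c2 a0 a1 a2 : R) : 0 <= c0 -> 0 <= c1 -> 0 <= c2 ->
  (forall t, 0 < t -> c0 * t `^ a0 <= c1 * t `^ a1 + c2 * t `^ a2) ->
  (c0%:E * egamma1 a0 <= c1%:E * egamma1 a1 + c2%:E * egamma1 a2)%E.
Proof.
move=> c00 c10 c20 H.
have mg z : measurable_fun (`]0%R, +oo[%classic : set (measurableTypeR R))
      (fun x : measurableTypeR R => (x `^ z * expR (- x))%:E).
  by apply: measurable_funTS; exact: measurable_gamma_integrand.
have oE z : egamma1 z = (\int[leb]_(x in `]0%R, +oo[) (x `^ z * expR (- x))%:E)%E.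
  by apply/esym/integral_itv_obnd_cbnd; exact: mg.
have g0 z x : (`]0%R, +oo[%classic : set R) x -> (0 <= (x `^ z * expR (- x))%:E)%E.
  by move=> _; exact: gamma_integrand_ge0.
rewrite !oE -(ge0_integralZl _ _ (mg a0))//; last exact: g0.
rewrite -(ge0_integralZl _ _ (mg a1))//; last exact: g0.
rewrite -(ge0_integralZl _ _ (mg a2))//; last exact: g0.
rewrite -ge0_integralD//.
- apply: ge0_le_integral => //.
  + by move=> x _; rewrite mule_ge0// ?lee_fin// mulr_ge0 ?powR_ge0 ?expR_ge0.
  + exact: measurable_funeM.
  + by apply: emeasurable_funD; exact: measurable_funeM.
  + move=> x; rewrite /= in_itv/= andbT => x0.
    rewrite -!EFinM -EFinD lee_fin !mulrA -mulrDl ler_wpM2r ?expR_ge0//.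
    exact: H.
- by move=> x _; rewrite mule_ge0// ?lee_fin// mulr_ge0 ?powR_ge0 ?expR_ge0.
- exact: measurable_funeM.
- by move=> x _; rewrite mule_ge0// ?lee_fin// mulr_ge0 ?powR_ge0 ?expR_ge0.
- exact: measurable_funeM.
Qed.

Lemma egamma1_fin_num z : 0 <= z -> egamma1 z \is a fin_num.
Proof.
move=> z0; rewrite ge0_fin_numE ?egamma1_ge0//.
(* For an integer M >= z, t^z <= 1 + t^M, so the integral is at most 1 + M!. *)
pose M := (Num.truncn z).+1.
have zM : z <= M%:R by exact/ltW/truncnS_gt.
have := @le_egamma1 1 1 1 z 0 M%:R ler01 ler01 ler01.
rewrite !mul1e egamma1_0 egamma1_nat => h; apply: le_lt_trans (h _) _.
  move=> t t0; rewrite !mul1r powRr0.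
  have [t1|t1] := leP t 1.
    have := @ger_powR _ t _ 0 z z0; rewrite t0 t1 powRr0 => /(_ isT) ?.
    by have := powR_ge0 t M%:R; lra.
  by have := ler_powR (ltW t1) zM; lra.
by rewrite -EFinD ltry.
Qed.

Lemma egamma1E z : 0 <= z -> egamma1 z = (Gamma (z + 1))%:E.
Proof. by move=> z0; rewrite GammaE fineK// egamma1_fin_num. Qed.

Lemma Gamma1_rec z : 0 <= z -> Gamma (z + 1 + 1) = (z + 1) * Gamma (z + 1).
Proof.
move=> z0; apply: EFin_inj; rewrite EFinM -!egamma1E ?egamma1S// addr_ge0//.
Qed.

Lemma Gamma1_nat n : Gamma (n%:R + 1) = n`!%:R :> R.
Proof. by apply: EFin_inj; rewrite -egamma1E ?egamma1_nat. Qed.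

Lemma le_Gamma1 (c0 c1 c2 a0 a1 a2 : R) : 0 <= c0 -> 0 <= c1 -> 0 <= c2 ->
  0 <= a0 -> 0 <= a1 -> 0 <= a2 ->
  (forall t, 0 < t -> c0 * t `^ a0 <= c1 * t `^ a1 + c2 * t `^ a2) ->
  c0 * Gamma (a0 + 1) <= c1 * Gamma (a1 + 1) + c2 * Gamma (a2 + 1).
Proof.
move=> c00 c10 c20 a00 a10 a20 H; rewrite -lee_fin EFinD !EFinM -!egamma1E//.
exact: le_egamma1.
Qed.

Lemma powR_div (x y z : R) : 0 < x -> 0 < y -> (x / y) `^ z = x `^ z / y `^ z.
Proof.
move=> /ltW x0 /ltW y0; rewrite powRM ?invr_ge0//.
by rewrite -[y^-1]powR_inv1// -powRrM mulN1r powRN.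
Qed.

(** With L = ln u, add exp (z L) >= 1 + z L and z exp (- L) >= z (1 - L). *)
Lemma powR_ge_tangent (u z : R) : 0 < u -> 0 <= z -> 1 + z <= u `^ z + z / u.
Proof.
move=> u0 z0; rewrite /powR gt_eqF//.
have -> : u^-1 = expR (- ln u) by rewrite expRN lnK ?posrE.
have := expR_ge1Dx (z * ln u).
have := ler_wpM2l z0 (expR_ge1Dx (- ln u)).
by lra.
Qed.

(** Weighted AM-GM for y and 1. With w = y^t, the tangent-line bounds [h1] and [h2], weighted by 1 -
    t and t, add up so that L cancels and w remains on the left. *)
Lemma powR_le_chord (y t : R) : 0 < y -> 0 <= t <= 1 -> y `^ t <= 1 - t + t * y.
Proof.
move=> y0 /andP[t0 t1]; rewrite /powR gt_eqF//.
have [L yE] : exists L, y = expR L by exists (ln y); rewrite lnK ?posrE.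
rewrite yE expRK; set w := expR (t * L).
have w0 : 0 <= w by exact: expR_ge0.
have h1 : w * (1 - t * L) <= 1.
  rewrite -[leRHS](expRxMexpNx_1 (t * L)); apply: ler_wpM2l => //.
  exact: expR_ge1Dx.
have h2 : w * (1 + (1 - t) * L) <= expR L.
  have -> : expR L = w * expR ((1 - t) * L) by rewrite -expRD; congr expR; ring.
  by apply: ler_wpM2l => //; exact: expR_ge1Dx.
have t1' : 0 <= 1 - t by lra.
have := ler_wpM2l t1' h1; have := ler_wpM2l t0 h2.
by lra.
Qed.

(** With N = n + 1, the tangent inequality at u = t / N, multiplied by N^z t^N exp (- t), integrates
    to (1 + z) N^z N! <= Gamma (N + z + 1) + z N^z N!. *)
Lemma Gamma1_lower n z : 0 <= z ->
  n.+1%:R `^ z * n.+1`!%:R <= Gamma (n.+1%:R + z + 1).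
Proof.
move=> z0; set N := n.+1%:R : R.
have N0 : 0 < N by rewrite ltr0n.
have Nz : 0 < N `^ z by exact: powR_gt0.
have := @le_Gamma1 (N `^ z * (1 + z)) 1 (N `^ z * z * N) N (N + z) n%:R.
rewrite !Gamma1_nat factS natrM mul1r => h.
suff : N `^ z * (1 + z) * (N * n`!%:R) <= Gamma (N + z + 1) + N `^ z * z * N * n`!%:R by lra.
apply: h => //.
- by rewrite mulr_ge0//; [exact: ltW|lra].
- by rewrite !mulr_ge0// ltW.
- by rewrite addr_ge0// ltW.
move=> t t0.
have tN : t `^ N = t * t `^ n%:R.
  by rewrite /N -natr1 powRD ?powRr1 ?(ltW t0)// 1?mulrC// (gt_eqF t0) implybT.
have u0 : 0 < t / N by rewrite divr_gt0.
have := powR_ge_tangent u0 z0.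
have -> : (t / N) `^ z = t `^ z / N `^ z.
  exact: powR_div.
have tz : t `^ (N + z) = t * t `^ n%:R * t `^ z.
  by rewrite powRD ?tN// (gt_eqF t0) implybT.
rewrite tz tN => h'.
have q0 : 0 <= N `^ z * (t * t `^ n%:R) by rewrite !mulr_ge0 ?powR_ge0// ltW.
have := ler_wpM2l q0 h'.
have -> : N `^ z * (t * t `^ n%:R) * (t `^ z / N `^ z + z / (t / N)) =
  1 * (t * t `^ n%:R * t `^ z) + N `^ z * z * N * t `^ n%:R.
  by field; rewrite !gt_eqF.
by lra.
Qed.

Lemma fact_addn_le n m (M : nat) : (m <= M)%N -> ((n + m)`! <= n`! * (n + M) ^ m)%N.
Proof.
elim: m => [|m ih] mM; first by rewrite addn0 expn0 muln1.
rewrite addnS factS expnS mulnCA leq_mul//; first by rewrite -addnS leq_add2l.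
by apply: ih; exact: ltnW.
Qed.

(** The chord inequality for (t / L)^M with exponent th = z / M bounds (t / L)^z; it is integrated
    against t^n exp (- t). Since (n + M)! / L^M <= n!, the terms of weight 1 - th and th merge. *)
Lemma Gamma1_upper n (M : nat) z : (0 < M)%N -> 0 <= z <= M%:R ->
  Gamma (n%:R + z + 1) <= (n + M)%:R `^ z * n`!%:R.
Proof.
move=> M0 /andP[z0 zM]; set L := (n + M)%:R : R.
have M0' : 0 < M%:R :> R by rewrite ltr0n.
have L0 : 0 < L by rewrite ltr0n addn_gt0 M0 orbT.
have Lz : 0 < L `^ z by exact: powR_gt0.
pose th := z / M%:R.
have th01 : 0 <= th <= 1 by rewrite divr_ge0//= ler_pdivrMr// mul1r.
have /andP[th0 th1] := th01.
have LM : 0 < L ^+ M by exact: exprn_gt0.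
have := @le_Gamma1 1 (L `^ z * (1 - th)) (L `^ z * th / L ^+ M) (n%:R + z) n%:R (n + M)%:R.
rewrite !Gamma1_nat mul1r => h.
apply: le_trans (h _ _ _ _ _ _ _) _ => //.
- by rewrite mulr_ge0 ?subr_ge0// ltW.
- by rewrite !mulr_ge0 ?invr_ge0// ltW.
- by rewrite addr_ge0.
- move=> t t0.
  have u0 : 0 < t / L by rewrite divr_gt0.
  have := @powR_le_chord ((t / L) ^+ M) th (exprn_gt0 _ u0) th01.
  have -> : ((t / L) ^+ M) `^ th = t `^ z / L `^ z.
    rewrite -powR_mulrn ?(ltW u0)// -powRrM /th mulrCA mulfV ?gt_eqF// mulr1.
    exact: powR_div.
  rewrite powRD ?(gt_eqF t0) ?implybT// natrD powRD ?(gt_eqF t0) ?implybT//.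
  rewrite !powR_mulrn ?(ltW t0)//.
  rewrite expr_div_n => h'.
  have q0 : 0 <= L `^ z * t ^+ n by rewrite !mulr_ge0 ?exprn_ge0// ltW.
  have := ler_wpM2l q0 h'.
  have -> : L `^ z * t ^+ n * (t `^ z / L `^ z) = 1 * (t ^+ n * t `^ z).
    by field; rewrite gt_eqF.
  by lra.
have fM : (n + M)`!%:R / L ^+ M <= n`!%:R.
  rewrite ler_pdivrMr// /L -natrX -natrM ler_nat; exact: fact_addn_le.
have q0 : 0 <= L `^ z * th by rewrite mulr_ge0// ltW.
have := ler_wpM2l q0 fM.
by lra.
Qed.

(** This is (z + 1) ... (z + n) / n!. *)
Definition euler_prod z n : R := \prod_(i < n) (1 + z / i.+1%:R).

Lemma euler_prod_Gamma z n : 0 <= z ->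
  euler_prod z n * Gamma (z + 1) * n`!%:R = Gamma (n%:R + z + 1).
Proof.
move=> z0; elim: n => [|n ih]; first by rewrite /euler_prod big_ord0 add0r mul1r mulr1.
rewrite /euler_prod big_ord_recr/= -/(euler_prod z n) -natr1.
have -> : n%:R + 1 + z + 1 = n%:R + z + 1 + 1 by ring.
rewrite Gamma1_rec ?addr_ge0// -ih factS natrM -natr1.
by field; rewrite natr1 pnatr_eq0.
Qed.

(** The expression equals Gamma (n + z + 1) / (n! n^z), which the two bounds squeeze between 1 and
    ((n + M) / n)^z. *)
Lemma euler_prod_cvg z : 0 <= z ->
  euler_prod z n * Gamma (z + 1) / n%:R `^ z @[n --> \oo] --> (1 : R).
Proof.
move=> z0; pose M := (Num.truncn z).+1.
have zM : 0 <= z <= M%:R by rewrite z0/=; exact/ltW/truncnS_gt.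
apply: (@squeeze_cvgr _ _ _ _ (cst 1) (fun n => (1 + M%:R / n%:R) `^ z)).
- near=> n.
  have n0 : (0 < n)%N by near: n; exists 1%N.
  have n0' : 0 < n%:R :> R by rewrite ltr0n.
  have nz : 0 < n%:R `^ z :> R by exact: powR_gt0.
  have f0 : 0 < n`!%:R :> R by rewrite ltr0n fact_gt0.
  have E := euler_prod_Gamma n z0.
  rewrite ler_pdivlMr// mul1r ler_pdivrMr//.
  rewrite -(ler_pM2r f0) E -[X in _ && X](ler_pM2r f0) E.
  apply/andP; split.
    by have := Gamma1_lower n.-1 z0; rewrite prednK.
  rewrite -powRM ?addr_ge0 ?divr_ge0// mulrDl mul1r divfK ?gt_eqF// -natrD.
  exact: Gamma1_upper.
- exact: cvg_cst.
- rewrite -[X in _ --> X](_ : (1 + 0) `^ z = 1); last by rewrite addr0 powR1.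
  have h : 1 + M%:R / n%:R @[n --> \oo] --> (1 + 0 : R).
    apply: cvgD; first exact: cvg_cst.
    rewrite -[X in _ --> X](mulr0 M%:R); apply: cvgMl_tmp.
    by rewrite -(@cvg_shiftS R); exact: cvg_harmonic.
  apply: (@cvg_comp _ _ _ (fun n => 1 + M%:R / n%:R) (@powR R ^~ z) _ (nbhs (1 + 0 : R))) => //.
  by apply: continuous_powR_base; rewrite addr0.
Unshelve. all: end_near. Qed.

End gamma.

(** * Determinacy from exponentially bounded moments *)

Section determinacy.
Context {R : realType}.
Notation rT := (measurableTypeR R).

(** With p the square root of r, p^n >= n (p - 1), so n / r^n <= p^(- n) / (p - 1). *)
Lemma natr_exp_inv_cvg0 (r : R) : 1 < r -> n%:R / r ^+ n @[n --> \oo] --> 0.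
Proof.
move=> r1; pose p := Num.sqrt r.
have r0 : 0 <= r by lra.
have p1 : 1 < p by rewrite -sqrtr1 ltr_sqrt//; lra.
have pr : p ^+ 2 = r by rewrite sqr_sqrtr.
have pp n : n%:R * (p - 1) <= p ^+ n.
  elim: n => [|n ih]; first by rewrite mul0r expr0.
  rewrite exprS -natr1.
  have q1 : 1 <= p ^+ n by apply: exprn_ege1; lra.
  have : 1 * (p - 1) <= p ^+ n * (p - 1) by apply: ler_wpM2r => //; lra.
  by lra.
apply: (@squeeze_cvgr _ _ _ _ (cst 0) (fun n => (p - 1)^-1 * p^-1 ^+ n)).
- near=> n; have p0 : 0 < p by lra.
  rewrite divr_ge0 ?ler0n ?exprn_ge0//=.
  rewrite -pr -exprM mulnC exprM expr2 invfM mulrA exprVn ler_pM2r ?invr_gt0 ?exprn_gt0//.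
  rewrite ler_pdivrMr ?exprn_gt0// ler_pdivlMl; last lra.
  by rewrite mulrC.
- exact: cvg_cst.
- rewrite -[X in _ --> X](mulr0 (p - 1)^-1).
  apply: cvgMl_tmp; apply: cvg_expr.
  rewrite ger0_norm ?invr_ge0 ?invf_lt1//; lra.
Unshelve. all: end_near. Qed.

Lemma one_sub_expr_ge (z : R) n : 0 <= z <= 1 -> 1 - n%:R * z <= (1 - z) ^+ n.
Proof.
move=> z01; elim: n => [|n ih]; first by rewrite mul0r subr0 expr0.
rewrite exprS -natr1.
have : (1 - z) * (1 - n%:R * z) <= (1 - z) * (1 - z) ^+ n.
  by apply: ler_wpM2l => //; lra.
have : 0 <= n%:R * z * z :> R by rewrite !mulr_ge0//; lra.
nra.
Qed.

(** The induction rests on (1 - z) (1 + (n + 1) z) = 1 + n z - (n + 1) z^2. *)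
Lemma one_sub_expr_le (z : R) n : 0 <= z <= 1 ->
  (1 - z) ^+ n * (1 + n%:R * z) <= 1.
Proof.
move=> z01; elim: n => [|n ih]; first by rewrite expr0 mul0r addr0 mulr1.
apply: le_trans ih; rewrite exprS -natr1 -mulrA mulrCA.
apply: ler_wpM2l; first by apply: exprn_ge0; lra.
have : 0 <= n%:R * z * z :> R by rewrite !mulr_ge0//; lra.
nra.
Qed.

Lemma poly_cvg_ray (x B : R) : 0 <= x -> 0 < B -> exists P : nat -> {poly R},
  (forall n t, 0 <= t <= B -> 0 <= (P n).[t] <= 1) /\
  (forall t, 0 <= t <= B -> (P n).[t] @[n --> \oo] --> ((x < t)%R%:R : R)).
Proof.
move=> x0 B0; have [->|xn0] := eqVneq x 0.
  (* At x = 0 the scale B / x is meaningless; plain powers of 1 - t / B separate t = 0 from t >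
     0. *)
  exists (fun n => 1 - (1 - B^-1 *: 'X) ^+ n); split => [n t /andP[t0 tB]|t /andP[t0 tB]].
    rewrite !hornerE.
    have : 0 <= 1 - B^-1 * t <= 1.
      by rewrite subr_ge0 mulrC ler_pdivrMr// mul1r tB gerBl divr_ge0// ltW.
    move=> /andP[u0 u1]; have := exprn_ge0 n u0; have := exprn_ile1 n u0 u1; lra.
  under eq_fun do rewrite !hornerE.
  move: t0; rewrite le_eqVlt => /predU1P[<-|t0].
    under eq_fun do rewrite mulr0 subr0 expr1n subrr.
    by rewrite ltxx; exact: cvg_cst.
  rewrite t0 (_ : true%:R = 1 - 0); last by rewrite subr0.
  apply: cvgB; first exact: cvg_cst.
  apply: cvg_expr.
  have : 0 < B^-1 * t by rewrite mulr_gt0 ?invr_gt0.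
  have : B^-1 * t <= 1 by rewrite mulrC ler_pdivrMr// mul1r.
  move=> ? ?; rewrite ger0_norm; lra.
have {x0 xn0}x0 : 0 < x by lra.
(* Without the division by [n] the polynomials would tend to [1 - exp (-1)] at
   [t = x] instead of 0. *)
pose N n := Num.truncn ((B / x) ^+ n / n%:R).
exists (fun n => 1 - (1 - B^-1 ^+ n *: 'X ^+ n) ^+ (N n)).
have PE n t : (1 - (1 - B^-1 ^+ n *: 'X ^+ n) ^+ (N n)).[t] = 1 - (1 - (t / B) ^+ n) ^+ (N n).
  by rewrite !hornerE exprMn mulrC.
have u01 n t : 0 <= t <= B -> 0 <= (t / B) ^+ n <= 1.
  move=> /andP[t0 tB]; rewrite exprn_ge0 ?divr_ge0//; last exact: ltW.
  by rewrite exprn_ile1 ?divr_ge0 ?ler_pdivrMr ?mul1r//; exact: ltW.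
split => [n t|t] tB; rewrite ?PE.
  have := u01 n t tB => /andP[v0 v1].
  have w0 : 0 <= 1 - (t / B) ^+ n by lra.
  have w1 : 1 - (t / B) ^+ n <= 1 by lra.
  have := exprn_ge0 (N n) w0; have := exprn_ile1 (N n) w0 w1; lra.
under eq_fun do rewrite PE.
have Bx0 n : 0 <= (B / x) ^+ n / n%:R.
  by rewrite divr_ge0 ?exprn_ge0 ?divr_ge0// ltW.
(* Put v = (t / B)^n. For t > x, N v is about (t / x)^n / n, so (1 - v)^N <= 1 / (1 + N v) tends to
   0. *)
have [xt|tx] := ltP x t.
  rewrite (_ : true%:R = 1 - 0); last by rewrite subr0.
  apply: cvgB; first exact: cvg_cst.
  have r1 : 1 < t / x by rewrite ltr_pdivlMr ?mul1r.
  apply: (@squeeze_cvgr _ _ _ _ (cst 0) (fun n => n%:R / (t / x) ^+ n)).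
  - near=> n; have := u01 n t tB => /andP[v0 v1].
    rewrite exprn_ge0 /=; last lra.
    have n0 : 0 < n%:R :> R by rewrite ltr0n; near: n; exists 1%N.
    rewrite ler_pdivlMr ?exprn_gt0//; last lra.
    have Nge : (B / x) ^+ n / n%:R <= (N n)%:R + 1.
      by rewrite natr1; exact/ltW/truncnS_gt.
    (* Truncation loses at most 1 in N, which costs at most v <= 1. *)
    have vN : (t / x) ^+ n <= n%:R * (1 + (N n)%:R * (t / B) ^+ n).
      have -> : (t / x) ^+ n = n%:R * ((B / x) ^+ n / n%:R * (t / B) ^+ n).
        rewrite mulrA mulrCA divff ?mulr1 ?gt_eqF// -exprMn; congr (_ ^+ _).
        by field; rewrite !gt_eqF.
      rewrite ler_pM2l//.
      by have := ler_wpM2r v0 Nge; lra.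
    have w0 : 0 <= (1 - (t / B) ^+ n) ^+ N n by apply: exprn_ge0; lra.
    apply: le_trans (ler_wpM2l w0 vN) _.
    have := @one_sub_expr_le ((t / B) ^+ n) (N n); rewrite v0 v1 => /(_ isT) h.
    by rewrite mulrCA -[leRHS]mulr1 ler_pM2l.
  - exact: cvg_cst.
  - exact: natr_exp_inv_cvg0.
(* For t <= x, N v <= (t / x)^n / n <= 1 / n, so Bernoulli's inequality gives 1 - (1 - v)^N <= 1 /
   n, which is [harmonic] at [n.-1]. *)
apply: (@squeeze_cvgr _ _ _ _ (cst 0) (@harmonic R \o predn)).
- near=> n; have := u01 n t tB => /andP[v0 v1].
  have w0 : 0 <= 1 - (t / B) ^+ n by lra.
  have w1 : 1 - (t / B) ^+ n <= 1 by lra.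
  have n0 : (0 < n)%N by near: n; exists 1%N.
  have := exprn_ile1 (N n) w0 w1.
  have := @one_sub_expr_ge ((t / B) ^+ n) (N n); rewrite v0 v1 => /(_ isT).
  have : (N n)%:R * (t / B) ^+ n <= n%:R^-1.
    have Nle : (N n)%:R <= (B / x) ^+ n / n%:R by rewrite Num.Theory.truncn_le.
    apply: le_trans (ler_wpM2r v0 Nle) _.
    rewrite mulrAC -[leRHS]mul1r ler_wpM2r ?invr_ge0//.
    rewrite -exprMn exprn_ile1//.
    + by rewrite mulr_ge0// divr_ge0//; lra.
    + have -> : B / x * (t / B) = t / x by field; rewrite !gt_eqF.
      by rewrite ler_pdivrMr ?mul1r.
  by rewrite /= prednK//; lra.
- exact: cvg_cst.
- rewrite -(@cvg_shiftS R); exact: cvg_harmonic.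
Unshelve. all: end_near. Qed.

Lemma representing_setT (mu : {measure set rT -> \bar R}) (m : nat -> R) :
  stieltjes_representing mu m -> mu setT = (m 0%N)%:E.
Proof.
move=> [mu0 mE]; rewrite mE.
under eq_integral do rewrite expr0.
rewrite integral_cst// mul1e.
rewrite (_ : setT = `[0%R, +oo[%classic `|` [set x : rT | (x < 0)%R]).
  rewrite measureU0//; rewrite -set_itvNyo; exact: measurable_itv.
rewrite predeqE => x; split => // _ /=; rewrite in_itv/= andbT.
by case: (leP 0 x) => ?; [left|right].
Qed.

(** Markov's inequality for the n-th moment bounds the mass by b^n / (2 b)^n = 2^(- n) for every
    n. *)
Lemma representing_tail0 (mu : {measure set rT -> \bar R}) (m : nat -> R) (b : R) :
  stieltjes_representing mu m -> 0 < b -> (forall n, m n <= b ^+ n) ->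
  mu `](2 * b)%R, +oo[%classic = 0%E.
Proof.
move=> rep b0 mb; have [mu0 mE] := rep.
have fin : mu `](2 * b)%R, +oo[%classic \is a fin_num.
  rewrite ge0_fin_numE//; apply: (@le_lt_trans _ _ (mu setT)).
    by apply: le_measure; rewrite ?inE.
  by rewrite (representing_setT rep) ltry.
have key n : fine (mu `](2 * b)%R, +oo[%classic) <= 2^-1 ^+ n.
  have : (((2 * b) ^+ n)%:E * mu `](2 * b)%R, +oo[%classic <= (b ^+ n)%:E)%E.
    apply: (@le_trans _ _ (m n)%:E); last by rewrite lee_fin.
    rewrite mE -integral_cst//.
    apply: (@le_trans _ _ (\int[mu]_(x in `](2 * b)%R, +oo[) (x ^+ n)%:E)%E).
      apply: ge0_le_integral => //=.
      - by move=> x _; rewrite lee_fin exprn_ge0// mulr_ge0// ltW.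
      - by apply/measurable_EFinP; exact: measurable_funTS.
      - move=> x; rewrite in_itv/= andbT => bx; rewrite lee_fin lerXn2r ?nnegrE//.
        + by rewrite mulr_ge0// ltW.
        + by apply: le_trans (ltW bx); rewrite mulr_ge0// ltW.
        + exact: ltW.
    apply: ge0_subset_integral => //=.
    - by apply/measurable_EFinP; exact: measurable_funTS.
    - by move=> x; rewrite in_itv/= andbT => bx; rewrite lee_fin exprn_ge0.
    - move=> x; rewrite /= !in_itv/= !andbT => bx; apply: le_trans (ltW bx).
      by rewrite mulr_ge0// ltW.
  rewrite -{1}(fineK fin) -EFinM lee_fin exprMn mulrAC.
  rewrite -[leRHS]mul1r ler_pM2r ?exprn_gt0// => h.
  by rewrite exprVn -[leRHS]mul1r ler_pdivlMr ?exprn_gt0// mulrC.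
apply/eqP; rewrite -(fineK fin) eqe eq_le fine_ge0// andbT.
have h0 : (GRing.exp (2^-1 : R)) @ \oo --> (0 : R).
  by apply: cvg_expr; rewrite ger0_norm ?invr_ge0// invf_lt1// ltr1n.
rewrite -(cvg_lim _ h0)//; apply: limr_ge; first by apply/cvg_ex; exists 0.
exact: nearW.
Qed.

Lemma integral_poly_moment (mu : {measure set rT -> \bar R}) (m : nat -> R) (p : {poly R}) :
  stieltjes_representing mu m ->
  mu.-integrable `[0%R, +oo[ (fun x : rT => (p.[x])%:E) /\
  (\int[mu]_(x in `[0%R, +oo[) (p.[x])%:E = (\sum_(i < size p) p`_i * m i)%:E)%E.
Proof.
move=> [mu0 mE].
have mono n : mu.-integrable `[0%R, +oo[ (fun x : rT => (x ^+ n)%:E).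
  apply/integrableP; split; first by apply/measurable_EFinP; exact: measurable_funTS.
  rewrite (_ : (\int[mu]_(x in _) _)%E = (m n)%:E) ?ltry// mE.
  apply: eq_integral => x; rewrite inE/= in_itv/= andbT => x0.
  by rewrite /= ger0_norm// exprn_ge0.
have E : (fun x : rT => (p.[x])%:E) = (fun x => \sum_(i < size p) (p`_i)%:E * (x ^+ i)%:E)%E.
  by apply/funext => x; rewrite horner_coef -sumEFin.
have int i : mu.-integrable `[0%R, +oo[ (fun x : rT => (p`_i)%:E * (x ^+ i)%:E)%E.
  by apply: integrableZl.
rewrite E; split; first by apply: integrable_sum.
rewrite integral_sum// -sumEFin; apply: eq_bigr => i _.
by rewrite integralZl// -mE.
Qed.

(** The sequence on the left depends on the moments only, so two representing measures can be
    compared on rays. *)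
Lemma representing_ray_cvg (mu : {measure set rT -> \bar R}) (m : nat -> R)
    (b x : R) (P : nat -> {poly R}) :
  stieltjes_representing mu m -> 0 < b -> (forall n, m n <= b ^+ n) -> 0 <= x ->
  (forall n t, 0 <= t <= 2 * b -> 0 <= (P n).[t] <= 1) ->
  (forall t, 0 <= t <= 2 * b -> (P n).[t] @[n --> \oo] --> ((x < t)%R%:R : R)) ->
  (\sum_(i < size (P n)) (P n)`_i * m i)%:E @[n --> \oo] --> mu `]x, +oo[%classic.
Proof.
move=> rep b0 mb x0 P01 Pcvg.
have tail0 := representing_tail0 rep b0 mb.
have finT : (mu setT < +oo)%E by rewrite (representing_setT rep) ltry.
have DE : `[0%R, +oo[%classic `\` `](2 * b)%R, +oo[%classic = `[0%R, (2 * b)%R]%classic :> set R.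
  rewrite predeqE => t /=; rewrite !in_itv/= !andbT; split.
    by move=> [-> /negP]; rewrite -leNgt.
  by move=> /andP[-> h]; split => //; apply/negP; rewrite -leNgt.
(* Discarding the null tail reduces the integral to [0, 2 b], where [P n] takes values in [0, 1]. *)
have PE n : (\sum_(i < size (P n)) (P n)`_i * m i)%:E =
    (\int[mu]_(t in `[0%R, (2 * b)%R]) ((P n).[t])%:E)%E.
  have [int <-] := integral_poly_moment (P n) rep.
  by rewrite (@negligible_integral _ _ _ mu _ `](2 * b)%R, +oo[%classic)// DE.
under eq_fun do rewrite PE.
have -> : mu `]x, +oo[%classic =
    (\int[mu]_(t in `[0%R, (2 * b)%R]) (\1_(`]x, +oo[%classic : set R) t)%:E)%E.
  rewrite integral_indic//.
  apply/eqP; rewrite eq_le; apply/andP; split; last first.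
    by apply: le_measure; rewrite ?inE//; exact: measurableI.
  rewrite -[leRHS]adde0 -{1}tail0.
  apply: le_trans (measureU2 _ _ _) => //; last exact: measurableI.
  apply: le_measure; rewrite ?inE//; first by apply: measurableU => //; exact: measurableI.
  move=> t /=; rewrite !in_itv/= !andbT => xt.
  by case: (leP t (2 * b)) => tb; [left; rewrite (le_trans x0 (ltW xt))|right].
apply: (@dominated_cvg _ _ _ mu _ _ _ _ (cst 1%E)) => //=.
- move=> n; apply/measurable_EFinP/measurable_funTS.
  by apply: continuous_measurable_fun; exact: continuous_horner.
- move=> t; rewrite in_itv/= => tb; apply: cvg_EFin; first exact: nearW.
  rewrite indicE (_ : (t \in _) = (x < t)); first exact: Pcvg.
  by rewrite mem_setE in_itv/= andbT.
- apply/integrableP; split => //.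
  rewrite /= normr1 integral_cst// mul1e; apply: le_lt_trans finT.
  by apply: le_measure; rewrite ?inE.
- move=> n t; rewrite in_itv/= => tb; have /andP[p0 p1] := P01 n t tb.
  by rewrite lee_fin ger0_norm.
Qed.

Lemma exp_bounded_moments_unique (mu nu : {measure set rT -> \bar R}) (m : nat -> R) (b : R) :
  stieltjes_representing mu m -> stieltjes_representing nu m ->
  0 < b -> (forall n, m n <= b ^+ n) ->
  forall A : set rT, measurable A -> mu A = nu A.
Proof.
move=> rmu rnu b0 mb; apply: measure_eq_rays => [|x].
  by rewrite (representing_setT rmu) ltry.
(* A ray from a negative point carries the full mass [m 0]. *)
have [x0|x0] := ltP x 0.
  suff neg (m' : {measure set rT -> \bar R}) : stieltjes_representing m' m ->
      m' `]x, +oo[%classic = (m 0%N)%:E by rewrite !neg.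
  move=> r; rewrite -(representing_setT r).
  rewrite (_ : setT = `]x, +oo[%classic `|` [set y : rT | (y < 0)%R]).
    rewrite measureU0//; last by case: r.
    by rewrite -set_itvNyo; exact: measurable_itv.
  rewrite predeqE => y; split => // _ /=; rewrite in_itv/= andbT.
  by case: (leP 0 y) => ?; [left; exact: lt_le_trans x0 _|right].
have [P [P01 Pcvg]] := poly_cvg_ray x0 (mulr_gt0 (ltr0n R 2) b0).
have c1 := representing_ray_cvg rmu b0 mb x0 P01 Pcvg.
have c2 := representing_ray_cvg rnu b0 mb x0 P01 Pcvg.
exact: cvg_unique c1 c2.
Qed.

End determinacy.

(** * Fuss-Catalan numbers *)

Section fuss_catalan.
Context {R : realType}.
Notation rT := (measurableTypeR R).
Variable k : nat.
Hypothesis k_gt0 : (0 < k)%N.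
Implicit Types (s c : R) (n : nat).

Let U : probability rT R := uniform_prob (@ltr01 R).

(* Euler's product writes [fc_mellin s] as a product of ratios of linear
   factors; sorting zeros and poles gives these pairs, in which every zero
   [- (n + (j + 2) / k)] lies to the left of its pole [- (n + (j + 1) / (k + 1))],
   the factors at the negative integers having cancelled. *)
Definition fc_ratio (n j : nat) s : R :=
  (1 + s / (n%:R + j.+2%:R / k%:R)) / (1 + s / (n%:R + j.+1%:R / (k + 1)%:R)).

(** The function F of the overview. *)
Definition fc_mellin s : R :=
  (k%:R * s + 1)^-1 *
    (Gamma ((k + 1)%:R * s + 1) / (Gamma (s + 1) * Gamma (k%:R * s + 1))).

(* The growth rate of the Fuss-Catalan numbers. *)
Definition fc_radius : R := (k + 1)%:R ^+ (k + 1) / k%:R ^+ k.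

Lemma euler_prod_add (z : R) m j : euler_prod z (m + j) =
  euler_prod z m * \prod_(i < j) (1 + z / (m + i).+1%:R).
Proof.
elim: j => [|j ih]; first by rewrite addn0 big_ord0 mulr1.
by rewrite addnS /euler_prod !big_ord_recr/= -/(euler_prod z (m + j)) ih mulrA.
Qed.

Lemma euler_prod_gt0 (z : R) n : 0 <= z -> 0 < euler_prod z n.
Proof.
by move=> z0; apply: prodr_gt0 => i _; rewrite ltr_pwDl// divr_ge0.
Qed.

(** From n to n + 1, the first Euler product gains the k numerators. The one in the denominator
    gains k + 1 factors: k denominators, and 1 + s / (n + 1), which cancels the new factor of
    [euler_prod s]. The extra index in k n + 1 accounts for the factor 1 + k s, removed by the
    division. *)
Lemma fc_ratio_prod s n : 0 <= s ->
  \prod_(N < n) \prod_(j < k) fc_ratio N j s =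
  euler_prod (k%:R * s) (k * n + 1) / (k%:R * s + 1) * euler_prod s n /
  euler_prod ((k + 1)%:R * s) ((k + 1) * n).
Proof.
move=> s0.
have k0 : 0 < k%:R :> R by rewrite ltr0n.
have k10 : 0 < (k + 1)%:R :> R by rewrite ltr0n addn1.
have ks0 : 0 <= k%:R * s by rewrite mulr_ge0.
have k1s0 : 0 <= (k + 1)%:R * s by rewrite mulr_ge0.
elim: n => [|n ih].
  rewrite big_ord0 !muln0 /euler_prod !big_ord0 big_ord_recl big_ord0 divr1 !mulr1 invr1 mulr1.
  by rewrite addrC divff// gt_eqF// ltr_wpDl.
rewrite big_ord_recr/= ih.
have -> : (k * n.+1 + 1 = k * n + 1 + k)%N by rewrite mulnS; lia.
rewrite (euler_prod_add _ (k * n + 1) k).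
have -> : ((k + 1) * n.+1 = (k + 1) * n + k.+1)%N by rewrite mulnS; lia.
rewrite (euler_prod_add _ ((k + 1) * n) k.+1) big_ord_recr/=.
rewrite [euler_prod s n.+1]/euler_prod big_ord_recr/= -/(euler_prod s n).
rewrite prodf_div.
have -> : \prod_(i < k) (1 + k%:R * s / (k * n + 1 + i).+1%:R) =
    \prod_(i < k) (1 + s / (n%:R + i.+2%:R / k%:R)).
  apply: eq_bigr => i _.
  rewrite (_ : (k * n + 1 + i).+1%:R = k%:R * n%:R + i.+2%:R :> R); last first.
    by rewrite -natrM -natrD; congr _%:R; lia.
  have p0 : 0 < k%:R * n%:R + i.+2%:R :> R by rewrite ltr_wpDl// mulr_ge0.
  by field; rewrite !gt_eqF.
have -> : \prod_(i < k) (1 + (k + 1)%:R * s / ((k + 1) * n + i).+1%:R) =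
    \prod_(i < k) (1 + s / (n%:R + i.+1%:R / (k + 1)%:R)).
  apply: eq_bigr => i _.
  rewrite (_ : ((k + 1) * n + i).+1%:R = (k + 1)%:R * n%:R + i.+1%:R :> R); last first.
    by rewrite -natrM -natrD; congr _%:R; lia.
  have p0 : 0 < (k + 1)%:R * n%:R + i.+1%:R :> R by rewrite ltr_wpDl// mulr_ge0.
  by field; rewrite !gt_eqF.
rewrite (_ : ((k + 1) * n + k).+1%:R = (k + 1)%:R * n.+1%:R :> R); last first.
  by rewrite -natrM; congr _%:R; lia.
set A := \prod_(i < k) _; set B := \prod_(i < k) _.
have B0 : 0 < B.
  apply: prodr_gt0 => i _; rewrite ltr_pwDl// divr_ge0//.
have e1_gt0 := euler_prod_gt0 ((k + 1) * n) k1s0.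
have n0 : 0 < n.+1%:R :> R by rewrite ltr0n.
have ns : 0 < n.+1%:R + s by rewrite ltr_pwDl.
have ks1 : 0 < k%:R * s + 1 by rewrite ltr_wpDl.
set e1 := euler_prod (_%:R * s) ((k + 1) * n)%N in e1_gt0 *.
set e2 := euler_prod s n; set e3 := euler_prod _ (k * n + 1).
move: n.+1%:R n0 ns => N n0 ns.
clearbody A B e1 e2 e3.
by field; rewrite !gt_eqF.
Qed.

(** The lower bound at n = 0 gives 1 <= Gamma (z + 2) = (z + 1) Gamma (z + 1). *)
Lemma Gamma1_gt0 (z : R) : 0 <= z -> 0 < Gamma (z + 1).
Proof.
move=> z0; have := Gamma1_lower 0 z0.
rewrite powR1 mul1r (_ : 1 + z + 1 = z + 1 + 1); last by ring.
rewrite Gamma1_rec// => h.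
have : 0 < (z + 1) * Gamma (z + 1) by apply: lt_le_trans h.
by rewrite pmulr_rgt0// ltr_wpDl.
Qed.

Lemma fc_mellin_gt0 s : 0 <= s -> 0 < fc_mellin s.
Proof.
move=> s0; have ks : 0 <= k%:R * s by rewrite mulr_ge0.
by rewrite mulr_gt0 ?invr_gt0 ?ltr_wpDl// divr_gt0 ?mulr_gt0 ?Gamma1_gt0// mulr_ge0.
Qed.

Lemma fc_radius_gt0 : 0 < fc_radius.
Proof. by rewrite divr_gt0 ?exprn_gt0 ?ltr0n// addn1. Qed.

Lemma cvg_affine_oo (a b : nat) : (0 < a)%N -> (a * n + b)%N @[n --> \oo] --> \oo.
Proof.
move=> a0 A [N _ NA]; exists N => // n /= Nn; apply: NA => /=.
by rewrite (leq_trans Nn)// (leq_trans (leq_pmull n a0))// leq_addr.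
Qed.

(** Once Euler's limit is applied to the three products, what remains is (k n + 1)^(k s) n^s / ((k +
    1) n)^((k + 1) s), which tends to k^(k s) / (k + 1)^((k + 1) s), the power -s of [fc_radius]. *)
Lemma fc_ratio_prod_cvg s : 0 <= s ->
  \prod_(N < n) \prod_(j < k) fc_ratio N j s @[n --> \oo] -->
  fc_mellin s / fc_radius `^ s.
Proof.
move=> s0.
have k0 : 0 < k%:R :> R by rewrite ltr0n.
have k10 : 0 < (k + 1)%:R :> R by rewrite ltr0n addn1.
have ks0 : 0 <= k%:R * s by rewrite mulr_ge0.
have k1s0 : 0 <= (k + 1)%:R * s by rewrite mulr_ge0.
pose E z n := euler_prod z n * Gamma (z + 1) / n%:R `^ z : R.
have c1 : E (k%:R * s) (k * n + 1)%N @[n --> \oo] --> (1 : R).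
  exact: (cvg_comp _ _ (@cvg_affine_oo k 1 k_gt0) (euler_prod_cvg ks0)).
have c2 : E s n @[n --> \oo] --> (1 : R) by exact: euler_prod_cvg.
have c3 : E ((k + 1)%:R * s) ((k + 1) * n)%N @[n --> \oo] --> (1 : R).
  have k1 : (0 < k + 1)%N by rewrite addn1.
  have := cvg_comp _ _ (@cvg_affine_oo (k + 1) 0 k1) (euler_prod_cvg k1s0).
  rewrite (_ : _ \o _ = fun n => E ((k + 1)%:R * s) ((k + 1) * n)%N)//.
  by apply/funext => n /=; rewrite addn0.
(* This is (k n + 1)^(k s) with n^(k s) taken out. *)
have c4 : (k%:R + n%:R^-1) `^ (k%:R * s) @[n --> \oo] --> (k%:R `^ (k%:R * s) : R).
  have h : k%:R + n%:R^-1 @[n --> \oo] --> (k%:R + 0 : R).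
    apply: cvgD; first exact: cvg_cst.
    by rewrite -(@cvg_shiftS R); exact: cvg_harmonic.
  rewrite addr0 in h.
  apply: (@cvg_comp _ _ _ (fun n => k%:R + n%:R^-1) (@powR R ^~ (k%:R * s)) _
    (nbhs (k%:R : R))) => //.
  exact: continuous_powR_base.
have lim : fc_mellin s / (k + 1)%:R `^ ((k + 1)%:R * s) *
    ((k%:R + n%:R^-1) `^ (k%:R * s)) *
    (E (k%:R * s) (k * n + 1)%N * E s n * (E ((k + 1)%:R * s) ((k + 1) * n)%N)^-1)
    @[n --> \oo] -->
  fc_mellin s / (k + 1)%:R `^ ((k + 1)%:R * s) * k%:R `^ (k%:R * s) * (1 * 1 * 1^-1).
  apply: cvgM; first by apply: cvgMl_tmp.
  by apply: cvgM; [exact: cvgM|apply: cvgV => //; exact: oner_neq0].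
have <- : fc_mellin s / (k + 1)%:R `^ ((k + 1)%:R * s) * k%:R `^ (k%:R * s) * (1 * 1 * 1^-1)
    = fc_mellin s / fc_radius `^ s.
  rewrite !mul1r invr1 mulr1 -!mulrA; congr (_ * _).
  have kk : (k%:R ^+ k)^-1 `^ s = (k%:R `^ (k%:R * s))^-1 :> R.
    by rewrite -powR_mulrn// -powRN -powRrM mulNr powRN.
  have k1k1 : ((k + 1)%:R ^+ (k + 1)) `^ s = (k + 1)%:R `^ ((k + 1)%:R * s) :> R.
    by rewrite -powR_mulrn// -powRrM.
  rewrite /fc_radius powRM ?exprn_ge0 ?invr_ge0 ?exprn_ge0// kk k1k1.
  by rewrite !invfM invrK.
apply: cvg_trans lim; apply: near_eq_cvg; near=> n.
have n0 : (0 < n)%N by near: n; exists 1%N.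
have n0' : 0 < n%:R :> R by rewrite ltr0n.
rewrite fc_ratio_prod// /E /fc_mellin.
have -> : (k * n + 1)%:R `^ (k%:R * s) = n%:R `^ (k%:R * s) * (k%:R + n%:R^-1) `^ (k%:R * s) :> R.
  rewrite -powRM ?addr_ge0 ?invr_ge0//; congr (_ `^ _).
  by rewrite natrD natrM mulrDr divff ?gt_eqF// mulrC.
have -> : ((k + 1) * n)%:R `^ ((k + 1)%:R * s) =
    (k + 1)%:R `^ ((k + 1)%:R * s) * (n%:R `^ (k%:R * s) * n%:R `^ s) :> R.
  rewrite natrM powRM//; congr (_ * _).
  rewrite -powRD; last by rewrite (gt_eqF n0') implybT.
  by congr (_ `^ _); rewrite natrD; ring.
have G1 := Gamma1_gt0 s0; have G2 := Gamma1_gt0 ks0; have G3 := Gamma1_gt0 k1s0.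
have e1 := euler_prod_gt0 ((k + 1) * n) k1s0.
have p1 : 0 < n%:R `^ s :> R by exact: powR_gt0.
have p2 : 0 < n%:R `^ (k%:R * s) :> R by exact: powR_gt0.
have p3 : 0 < (k + 1)%:R `^ ((k + 1)%:R * s) :> R by exact: powR_gt0.
have p4 : 0 < (k%:R + n%:R^-1) `^ (k%:R * s) :> R.
  by apply: powR_gt0; rewrite ltr_pwDl ?invr_ge0.
move: (Gamma _) (Gamma _) (Gamma _) G1 G2 G3 => g1 g2 g3 G1 G2 G3.
by field; rewrite !gt_eqF// ltr_wpDl.
Unshelve. all: end_near. Qed.

Lemma fc_mellin_measure c : 0 < c ->
  exists mu : {measure set rT -> \bar R},
    mu [set x : R | x < 0] = 0%E /\
    forall s, 0 <= s -> (\int[mu]_(t in `[0%R, +oo[) (t `^ s)%:E = (fc_mellin s `^ c)%:E)%E.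
Proof.
move=> c0.
pose h n s := \prod_(j < k) (fc_ratio n j s `^ c).
have k0 : 0 < k%:R :> R by rewrite ltr0n.
have k10 : 0 < (k + 1)%:R :> R by rewrite ltr0n addn1.
have ratio_ge0 n j s : 0 <= s -> 0 <= fc_ratio n j s.
  by move=> s0; rewrite divr_ge0// addr_ge0// divr_ge0// addr_ge0// divr_ge0.
have hh n : laplace_rep (h n).
  apply: laplace_rep_prod => j; apply: laplace_rep_ratio_powR; last exact: ltW.
  (* The pair is ordered because (j + 1) / (k + 1) <= (j + 2) / k. *)
  rewrite ltr_wpDl ?divr_gt0//= lerD2l.
  rewrite ler_pdivrMr// mulrAC ler_pdivlMr// -!natrM ler_nat; nia.
have h0 n : h n 0 = 1.
  by rewrite /h big1// => j _; rewrite /fc_ratio !mul0r !addr0 divr1 powR1.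
have prodpow (I : Type) (r : seq I) (F : I -> R) : (forall i, 0 <= F i) ->
    \prod_(i <- r) (F i `^ c) = (\prod_(i <- r) F i) `^ c.
  move=> F0; elim: r => [|i r ih]; first by rewrite !big_nil powR1.
  by rewrite !big_cons ih powRM// prodr_ge0.
have hE n s : 0 <= s -> \prod_(N < n) h N s =
    (\prod_(N < n) \prod_(j < k) fc_ratio N j s) `^ c.
  move=> s0; rewrite -prodpow; last by move=> N; apply: prodr_ge0 => j _; exact: ratio_ge0.
  by apply: eq_bigr => N _; rewrite /h prodpow// => j; exact: ratio_ge0.
have hlim s : 0 <= s ->
    \prod_(N < n) h N s @[n --> \oo] --> (fc_mellin s / fc_radius `^ s) `^ c.
  move=> s0; under eq_fun do rewrite hE//.
  apply: powR_cvg_seq => //; last exact: fc_ratio_prod_cvg.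
  by move=> n; apply: prodr_ge0 => N _; apply: prodr_ge0 => j _; exact: ratio_ge0.
have [q [mq q01 qE]] := laplace_rep_prod_limit hh h0 hlim.
(* Scaling by the c-th power of [fc_radius] undoes the division by its power s inside the limit. *)
pose phi (u : rT) : rT := fc_radius `^ c * q u.
have mphi : measurable_fun setT phi by apply: measurable_funM.
have phi0 u : 0 <= phi u.
  by rewrite mulr_ge0 ?powR_ge0//; case/andP: (q01 u).
have [mu [muA muE]] := pushforward_exists U mphi.
exists mu; split.
  rewrite muA (_ : _ @^-1` _ = set0) ?measure0// predeqE => u; split => //=.
  by apply/negP; rewrite -leNgt.
move=> s s0; rewrite integral_mkcond muE; last 2 first.
- apply/measurable_restrict => //; rewrite ?setTI.
  by apply/measurable_EFinP/measurable_funTS.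
- by move=> y; apply: erestrict_ge0 => ? _; rewrite lee_fin powR_ge0.
transitivity (\int[U]_u ((fc_radius `^ (c * s))%:E * (q u `^ s)%:E))%E.
  apply: eq_integral => u _; rewrite patchE mem_set/= ?in_itv/= ?phi0//.
  by rewrite /phi powRM ?powR_ge0 -?powRrM ?EFinM//; case/andP: (q01 u).
have mqs : measurable_fun [set: rT] (fun u => (q u `^ s)%:E).
  by apply/measurable_EFinP; exact: (measurableT_comp (measurable_powR s) mq).
rewrite (ge0_integralZl _ _ mqs) ?lee_fin ?powR_ge0//; last first.
  by move=> u _; rewrite lee_fin powR_ge0.
rewrite qE// -EFinM; congr EFin.
have r0 := fc_radius_gt0; have f0 := fc_mellin_gt0 s0.
rewrite powRrM powRAC -powRM ?powR_ge0 ?divr_ge0 ?powR_ge0 ?(ltW f0)//.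
by congr (_ `^ _); rewrite mulrC divfK// gt_eqF// powR_gt0.
Qed.

Lemma fc_mellin_nat n : fc_mellin n%:R = fuss_catalan R k n.
Proof.
rewrite /fc_mellin /fuss_catalan -!natrM !Gamma1_nat natrD natrM; congr (_ * _).
have nk : (n <= (k + 1) * n)%N by rewrite leq_pmull// addn1.
have := bin_fact nk.
rewrite (_ : ((k + 1) * n - n)%N = (k * n)%N); last by lia.
move=> <-; rewrite !natrM.
by field; rewrite !pnatr_eq0 -!lt0n !fact_gt0.
Qed.

Lemma fuss_catalan_powR_exists c : 0 < c ->
  exists mu : {measure set rT -> \bar R},
    stieltjes_representing mu (fun n => fuss_catalan R k n `^ c) /\
    forall s, 0 <= s -> (\int[mu]_(t in `[0%R, +oo[) (t `^ s)%:E = (fc_mellin s `^ c)%:E)%E.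
Proof.
move=> c0; have [mu [mu0 muE]] := fc_mellin_measure c0.
exists mu; split => //; split => // n.
rewrite -fc_mellin_nat -muE//; apply: eq_integral => t.
by rewrite inE/= in_itv/= andbT => t0; rewrite powR_mulrn.
Qed.

(** The binomial coefficient is one term in the expansion of (1 + 1)^((k + 1) n). This is the
    exponential bound from which determinacy follows. *)
Lemma fuss_catalan_powR_le c n : 0 < c ->
  fuss_catalan R k n `^ c <= ((2 ^ (k + 1))%:R `^ c) ^+ n.
Proof.
move=> c0; rewrite -powR_mulrn ?powR_ge0// powRAC powR_mulrn//.
apply: ge0_ler_powR; rewrite ?nnegrE ?(ltW c0) ?mulr_ge0 ?invr_ge0 ?exprn_ge0//.
apply: (@le_trans _ _ ('C((k + 1) * n, n)%:R)).
  by rewrite ler_piMl// invf_le1 ?ltr0n ?addn1// ler1n.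
rewrite -natrX ler_nat -expnM.
have nk : (n < ((k + 1) * n).+1)%N by rewrite ltnS leq_pmull// addn1.
rewrite -[2%N]/(1 + 1)%N expnDn (bigD1 (Ordinal nk))//= !exp1n !muln1.
exact: leq_addr.
Qed.

End fuss_catalan.

Theorem theorem5 (R : realType) (k : nat) (hk : (2 <= k)%N) :
  [/\ infinitely_divisible (fuss_catalan R k),
      forall c : R, 0 < c ->
        stieltjes_determinate (fun n => fuss_catalan R k n `^ c)
    & forall (c : R) (mu : {measure set (measurableTypeR R) -> \bar R}),
        0 < c ->
        stieltjes_representing mu (fun n => fuss_catalan R k n `^ c) ->
        forall s : R, 0 <= s ->
          (\int[mu]_(t in `[0%R, +oo[) (t `^ s)%:E)%E =
          (((k%:R * s + 1)^-1 *
            (Gamma ((k + 1)%:R * s + 1) /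
             (Gamma (s + 1) * Gamma (k%:R * s + 1)))) `^ c)%:E].
Proof.
have k0 : (0 < k)%N by exact: leq_trans hk.
have ex c : 0 < c -> stieltjes_moment_sequence (fun n => fuss_catalan R k n `^ c).
  by move=> /(fuss_catalan_powR_exists k0)[mu [mu_rep _]]; exists mu.
have uniq c (mu nu : {measure set (measurableTypeR R) -> \bar R}) : 0 < c ->
    stieltjes_representing mu (fun n => fuss_catalan R k n `^ c) ->
    stieltjes_representing nu (fun n => fuss_catalan R k n `^ c) ->
    forall A : set (measurableTypeR R), measurable A -> mu A = nu A.
  move=> c0 mu_rep nu_rep.
  apply: (exp_bounded_moments_unique mu_rep nu_rep (b := (2 ^ (k + 1))%:R `^ c)).
    by rewrite powR_gt0// ltr0n expn_gt0.
  by move=> n; exact: fuss_catalan_powR_le.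
split.
- split => //.
  (* The sequence itself is its own power with c = 1. *)
  have := ex 1 ltr01; congr stieltjes_moment_sequence; apply/funext => n.
  by rewrite powRr1// mulr_ge0 ?invr_ge0.
- by move=> c c0; split; [exact: ex|move=> mu nu; exact: uniq].
- move=> c mu c0 mu_rep s s0.
  (* The transform is known for the constructed [nu]; uniqueness carries it over to the given
     [mu]. *)
  have [nu [nu_rep nuE]] := fuss_catalan_powR_exists k0 c0.
  rewrite -nuE//; apply: eq_measure_integral => A mA _.
  exact: (uniq c).
Qed.
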